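(* Let $G$ be a graph of type $\mathscr{G}_{\mathrm{II}}(A,B)$ and $\tilde G$ its component graph. If $\tilde G$ is a tree, then, for some $a,b,c\in\mathbb{Z}^+$, one of the following holds: (i) $G$ is an $(a,b)$-tree; or (ii) $\tilde G$ has only one $B$-node, and there exists $i\in A$ such that $G[\{i\}\cup B]$ is a $b$-cycle or the complete graph $K_{q+1}^{b,c}$ with root $i$, and all other nodes of $\tilde G$ correspond to $a$-trees in $G$; or the same statement holds with the roles of $A$ and $B$ interchanged.
   Context: A graph is a finite, connected, undirected, loopless multigraph with a root, viewed as a simple graph with edge-weight function $wt$ counting parallel edges. For $U\subseteq V$, $i\in U$, $d_U(i)=\sum_{j\notin U}wt(\{i,j\})$; a parking function of a rooted graph is an assignment $(b_i)$ of non-negative integers to the non-root vertices such that every non-empty set $U$ of non-root vertices contains $i$ with $b_i<d_U(i)$; $\mathcal{PF}(G)$ is their set. $G$ has type $\mathscr{G}_{\mathrm{II}}(A,B)$ if $V(G)=\{0\}\cup A\cup B$ with root $0$, $A=\{1,\dots,p\}$, $B=\{p+1,\dots,p+q\}$, $p,q\in\mathbb{Z}^+$; neither $G_A=G[\{0\}\cup A]$ nor $G_B=G[\{0\}\cup B]$ is connected; and $\mathcal{PF}(G)$ is invariant under $\mathfrak{S}_p\times\mathfrak{S}_q$ acting by permuting $(b_1,\dots,b_p)$ and $(b_{p+1},\dots,b_{p+q})$ separately. The component graph $\tilde G$ is the quotient of $G$ by: $u\sim v$ iff, for $S=A$ or $S=B$, $u,v\in S$ and some connected component of $G_S$ contains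 both; $0$ forms its own class (the $0$-node); classes inside $A$ (resp. $B$) are $A$-nodes (resp. $B$-nodes). Distinct nodes are adjacent in $\tilde G$ iff some vertex of one is adjacent in $G$ to some vertex of the other. A node ''corresponds to an $a$-tree'' when the subgraph of $G$ induced by its vertices is a tree all of whose edges have weight $a$. $G[S]$ is the induced subgraph with inherited weights. An $x$-cycle is a cycle with all edge weights $x$; $K_{q+1}^{b,c}$ with root $i$ is the complete graph on $\{i\}\cup B$ with weight $b$ on edges at $i$ and $c$ on edges inside $B$. A tree $G$ rooted at $0$ is an $(a,b)$-tree if each edge $\{i,j\}$, with $j$ the endpoint farther from $0$, has weight $a$ if $j\in A$ and $b$ if $j\in B$.
   Formalization: A node adjacent to the root 0 is said to correspond to an a-tree when the subgraph induced by its vertices together with 0 is an a-tree; with the node's vertices alone the claim is false, since such a node may be joined only through 0. *)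

(* Defs.v *)
From mathcomp Require Import all_boot all_fingroup.

Set Implicit Arguments.
Unset Strict Implicit.
Unset Printing Implicit Defensive.

(* Simple graphs are symmetric irreflexive relations on a finite type; all   *)
(* the notions below are relative to a vertex set S.                         *)
Section SimpleGraphs.
Variables (T : finType) (e : rel T).
Implicit Type S : {set T}.

Definition induced S : rel T := [rel x y | [&& x \in S, y \in S & e x y]].

Definition connected_on S : Prop :=
  {in S &, forall x y, connect (induced S) x y}.

(* A duplicate-free closed walk of length at most 2 is a vertex or an edge   *)
(* traversed back and forth, so only those of length at least 3 are cycles.  *)
Definition acyclic_on S : Prop :=
  forall c : seq T, ucycle (induced S) c -> size c < 3.

Definition tree_on S : Prop :=
  [/\ S != set0, connected_on S & acyclic_on S].

End SimpleGraphs.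

(* Connected loopless multigraphs with vertex set {0, ..., n} and root 0;    *)
(* wt i j is the number of parallel edges between i and j.                   *)
Record rooted_graph (n : nat) := RootedGraph {
  wt : 'I_n.+1 -> 'I_n.+1 -> nat;
  wt_sym : forall i j, wt i j = wt j i;
  wt_loopless : forall i, wt i i = 0;
  wt_connected : connected_on [rel i j | 0 < wt i j] [set: 'I_n.+1]
}.

Definition adj n (G : rooted_graph n) : rel 'I_n.+1 := [rel i j | 0 < wt G i j].

Definition outdeg n (G : rooted_graph n) (U : {set 'I_n.+1}) (i : 'I_n.+1) :=
  \sum_(j | j \notin U) wt G i j.

(* The non-root vertex number i + 1 is represented by i : 'I_n, that is, by  *)
(* lift ord0 i as a vertex.                                                  *)
Definition parking n (G : rooted_graph n) (b : 'I_n -> nat) : Prop :=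
  forall U : {set 'I_n}, U != set0 ->
  exists2 i, i \in U & b i < outdeg G (lift ord0 @: U) (lift ord0 i).

Definition permute_blocks p q (s : 'S_p) (t : 'S_q) (b : 'I_(p + q) -> nat)
    (k : 'I_(p + q)) : nat :=
  match split k with
  | inl i => b (lshift q (s i))
  | inr j => b (rshift p (t j))
  end.

Definition Aset p q := [set v : 'I_(p + q).+1 | 0 < v <= p].
Definition Bset p q := [set v : 'I_(p + q).+1 | p < v].

Definition type_II p q (G : rooted_graph (p + q)) : Prop :=
  [/\ ~ connected_on (adj G) (ord0 |: Aset p q),
      ~ connected_on (adj G) (ord0 |: Bset p q)
    & forall (s : 'S_p) (t : 'S_q) (b : 'I_(p + q) -> nat),
        parking G b -> parking G (permute_blocks s t b)].

Definition same_component n (G : rooted_graph n) (S : {set 'I_n.+1})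
    : rel 'I_n.+1 :=
  [rel u v | [&& u \in S, v \in S & connect (induced (adj G) (ord0 |: S)) u v]].

Section ComponentGraph.
Variables (p q : nat) (G : rooted_graph (p + q)).
Local Notation V := 'I_(p + q).+1.

Definition node_equiv : rel V :=
  [rel u v | [|| (u == ord0) && (v == ord0),
                 same_component G (Aset p q) u v
               | same_component G (Bset p q) u v]].

Definition nodes : {set {set V}} := equivalence_partition node_equiv [set: V].

Definition nodes_in (S : {set V}) : {set {set V}} :=
  [set N in nodes | N \subset S].

Definition node_adj : rel {set V} :=
  [rel N M : {set V} | (N != M) && [exists u in N, exists v in M, adj G u v]].

Definition component_graph_is_tree : Prop := tree_on node_adj nodes.

End ComponentGraph.

Section Shapes.
Variables (n : nat) (G : rooted_graph n).
Local Notation V := 'I_n.+1.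
Implicit Type S : {set V}.

Definition weighted_tree (a : nat) S : Prop :=
  tree_on (adj G) S /\ {in S &, forall x y, adj G x y -> wt G x y = a}.

(* An A-node is a connected component of G_A with the root removed if the    *)
(* component contained it, and likewise for B-nodes.  The vertices of the    *)
(* component are those of the node, together with the root as soon as it is  *)
(* adjacent to some vertex of the node; without the root, a node in the      *)
(* component of 0 need not even induce a connected graph.                    *)
Definition node_component (N : {set V}) : {set V} :=
  if [exists v in N, adj G ord0 v] then ord0 |: N else N.

Definition corresponds_to_tree (a : nat) (N : {set V}) : Prop :=
  weighted_tree a (node_component N).

Definition weighted_cycle (b : nat) S : Prop :=
  exists c : seq V,
    [/\ uniq c, 2 < size c, c =i S
      & {in S &, forall x y,
          wt G x y = if (y == next c x) || (x == next c y) then b else 0}].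

Definition weighted_complete (i : V) (b c : nat) S : Prop :=
  {in i |: S &, forall x y,
    x != y -> wt G x y = if (x == i) || (y == i) then b else c}.

(* j is strictly farther from the root than i.                               *)
Definition farther (i j : V) : Prop :=
  exists s, [/\ path (adj G) ord0 s, last ord0 s = i
    & forall t, path (adj G) ord0 t -> last ord0 t = j -> size s < size t].

End Shapes.

Section Conclusions.
Variables (p q : nat) (G : rooted_graph (p + q)).
Local Notation V := 'I_(p + q).+1.

Definition ab_tree (a b : nat) : Prop :=
  tree_on (adj G) [set: V] /\
  forall i j, adj G i j -> farther G i j ->
    (j \in Aset p q -> wt G i j = a) /\ (j \in Bset p q -> wt G i j = b).

(* Stated for an arbitrary pair (S, S'), to be used with (A, B) and (B, A).  *)
Definition one_big_node (S S' : {set V}) (a b c : nat) : Prop :=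
  [/\ #|nodes_in G S'| = 1,
      exists2 i, i \in S &
        weighted_cycle G b (i |: S') \/ weighted_complete G i b c S'
    & forall N, N \in nodes G -> N \notin nodes_in G S' ->
        corresponds_to_tree G a N].

End Conclusions.

(* Main.v *)
Require Import Defs.
From mathcomp Require Import all_boot all_fingroup.

(* For non-root u and w, the parking functions supported on {u, w} form an L-shaped region whose
   corner is governed by the weights from u and w to the vertices that the root reaches when u
   and w are removed; call the pair entangled if the region is not a box. The symmetry makes
   entanglement and the sizes of these regions depend only on the sides (A or B) of u and w.

   If no pair is entangled, adjacent non-root vertices dominate one another (one of them lies on
   every path from the root to the other), so G is a tree. If the entangled pairs lie inside one
   side Y, then all of Y hangs from a single vertex i outside Y, and constancy of the corner
   forces all edges inside Y to have the same weight and {i} with Y to be complete or a cycle.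
   If A-B pairs are entangled, then no vertex other than the root dominates another, and when
   the component graph is a tree this leaves a single node P on the side not adjacent to the
   root, with all vertices of the other side X pairwise non-adjacent. Assigning 0 to P and to
   one vertex w of X, and the largest possible value to the rest of X, then gives a parking
   function if w is a suitable neighbour of the root, but not if w is not adjacent to the
   root. *)

Set Implicit Arguments.
Unset Strict Implicit.
Unset Printing Implicit Defensive.

(** * Vertices reached from the root *)

Lemma connect_stable (T : finType) (e : rel T) (K : {pred T}) x y :
  (forall u v, u \in K -> e u v -> v \in K) -> connect e x y -> x \in K -> y \in K.
Proof.
move=> closedK /connectP[s + ->]; elim: s x => //= z s IHs x /andP[exz path_s] Kx.
exact: IHs path_s (closedK _ _ Kx exz).
Qed.

Lemma inducedE (T : finType) (e : rel T) (S : {set T}) x y :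
  induced e S x y = [&& x \in S, y \in S & e x y].
Proof. by []. Qed.

Lemma next_neq_prev (T : eqType) (c : seq T) x : uniq c -> 2 < size c -> x \in c ->
  next c x != prev c x.
Proof.
move=> uniq_c sz cx; apply/eqP => E; have := next_prev uniq_c x; rewrite -E => {E}.
case: (rot_to cx) uniq_c sz => k s def_s uniq_c.
rewrite -(size_rot k) -!(next_rot k uniq_c) def_s; rewrite -(rot_uniq k) def_s in uniq_c.
case: s uniq_c {def_s} => [|y [|z s]] //= /andP[/norP[xy /norP[xz _]] _] _.
by rewrite !eqxx eq_sym (negPf xy) => zx; rewrite zx eqxx in xz.
Qed.

Section Reach.
Variables (n : nat) (G : rooted_graph n).
Local Notation V := 'I_n.+1.
Implicit Types (S : {set V}) (u v w x y z : V).

Lemma adjC x y : adj G x y = adj G y x.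
Proof. by rewrite /adj /= wt_sym. Qed.

Lemma adjxx x : adj G x x = false.
Proof. by rewrite /adj /= wt_loopless. Qed.

Lemma adj_neq x y : adj G x y -> x != y.
Proof. by apply: contraTneq => ->; rewrite adjxx. Qed.

Lemma graph_connected x y : connect (adj G) x y.
Proof.
apply: connect_sub (wt_connected G (in_setT x) (in_setT y)) => u v /=.
by case/and3P=> _ _ uv; apply: connect1.
Qed.

(** When the root is not in [S], this is the component of the root after [S] is deleted: what burns
    in Dhar's algorithm while the vertices of [S] resist. *)
Definition reach S : {set V} := [set x | connect (induced (adj G) (~: S)) ord0 x].

Lemma in_reach S x : (x \in reach S) = connect (induced (adj G) (~: S)) ord0 x.
Proof. exact: in_set. Qed.

Lemma reach0 S : ord0 \in reach S.
Proof. by rewrite in_reach. Qed.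

Lemma reach_next S x y :
  x \in reach S -> x \notin S -> y \notin S -> adj G x y -> y \in reach S.
Proof.
move=> Rx Sx Sy xy; rewrite in_reach in Rx.
by rewrite in_reach; apply: connect_trans Rx (connect1 _); rewrite inducedE !in_setC Sx Sy.
Qed.

Lemma reach_ind S (K : {pred V}) :
  ord0 \in K ->
  (forall x y, x \in reach S -> x \in K -> x \notin S -> y \notin S ->
     adj G x y -> y \in K) ->
  {subset reach S <= K}.
Proof.
move=> K0 stepK x; rewrite in_reach => conn0x.
suff: x \in [pred z | (z \in K) && (z \in reach S)] by case/andP.
apply: (connect_stable _ conn0x); last by rewrite inE K0 reach0.
move=> u v /andP[Ku Ru]; rewrite inducedE !in_setC => /and3P[Su Sv uv].
by apply/andP; split; [apply: stepK uv | apply: reach_next uv].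
Qed.

Lemma reach_notin S x : ord0 \notin S -> x \in reach S -> x \notin S.
Proof. by move=> S0; move: x; apply: (@reach_ind S [pred x | x \notin S]). Qed.

Lemma reach_step S x y : ord0 \notin S ->
  x \in reach S -> adj G x y -> y \notin S -> y \in reach S.
Proof.
by move=> S0 Rx xy Sy; apply: reach_next Rx (reach_notin S0 Rx) Sy xy.
Qed.

(** A walk from the root avoiding [S] stays in [reach S]; if that set misses [S'], the same walk
    avoids [S']. *)
Lemma reach_sub S S' : ord0 \notin S' ->
  {in reach S, forall x, x \notin S'} -> reach S \subset reach S'.
Proof.
move=> S'0 disj; apply/subsetP.
suff: {subset reach S <= [pred x in reach S' | x \in reach S]}.
  by move=> sub x /sub /andP[].
apply: reach_ind => [|x y Rx /andP[R'x _] Sx Sy xy]; first by rewrite inE !reach0.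
have Ry := reach_next Rx Sx Sy xy.
by rewrite inE Ry andbT (reach_step S'0 R'x xy) ?disj.
Qed.

Lemma reachS S S' : ord0 \notin S' -> S \subset S' -> reach S' \subset reach S.
Proof.
move=> S'0 sSS'; apply: reach_sub => [|x /(reach_notin S'0)].
  by apply: contra S'0; apply: subsetP.
by apply: contra; apply: subsetP.
Qed.

Lemma reach_closedT (K : {pred V}) : ord0 \in K ->
  (forall x y, x \in K -> adj G x y -> y \in K) -> forall x, x \in K.
Proof. by move=> K0 stepK x; apply: (connect_stable stepK (graph_connected ord0 x)). Qed.

Lemma reach_set0 x : x \in reach set0.
Proof.
move: x; apply: reach_closedT (reach0 _) _ => x y Rx xy.
by apply: reach_step Rx xy _; rewrite inE.
Qed.

(** Here t precedes the first visit to x. Without it, [reach (x |: S)] would be closed under steps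
    avoiding [S] and would contain x. *)
Lemma reach_entry S x : ord0 \notin S -> x \in reach S -> x != ord0 ->
  exists2 t, t \in reach (x |: S) & adj G t x.
Proof.
move=> S0 Rx x0; apply/exists_inP; apply: contraTT Rx => /exists_inPn no_t.
have xS0 : ord0 \notin x |: S by rewrite !inE negb_or eq_sym x0.
suff sub : {subset reach S <= reach (x |: S)}.
  by apply/negP => /sub /(reach_notin xS0); rewrite !inE eqxx.
apply: reach_ind => [|y z _ Ry _ Sz yz]; first exact: reach0.
apply: (reach_step xS0 Ry yz); rewrite !inE negb_or Sz andbT.
by apply: contraTneq yz => ->; apply: no_t.
Qed.

Lemma reach_exit S (U : {set V}) i : ord0 \notin U -> i \in U -> i \in reach S ->
  exists i' j, [/\ i' \in U, i' \in reach S, j \in reach S, j \notin U & adj G i' j].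
Proof.
move=> U0 Ui Ri.
have [/existsP[i' /existsP[j /and5P[? ? ? ? ?]]]|] :=
  boolP [exists i', exists j,
    [&& i' \in U, i' \in reach S, j \in reach S, j \notin U & adj G i' j]].
  by exists i', j.
move/existsPn=> noexit; exfalso.
suff sub : {subset reach S <= [pred x | (x \in reach S) && (x \notin U)]}.
  by have /andP[_ /negP[]] := sub _ Ri.
apply: reach_ind => [|x y Rx /andP[_ Ux] Sx Sy xy]; first by rewrite inE reach0 U0.
have Ry := reach_next Rx Sx Sy xy.
rewrite inE Ry /=; apply: contra (noexit y) => Uy.
by apply/existsP; exists x; rewrite Uy Ry Rx Ux adjC xy.
Qed.

(** * Masses, entangled pairs and domination *)

Definition wdeg u S := \sum_(j in S) wt G u j.

(* [mass u - 1] is the largest value at u of a parking function, and [pmass u w - 1] the largest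
   value at u when w takes a value too large for it to burn before u. *)
Definition mass u := wdeg u (reach [set u]).
Definition pmass u w := wdeg u (reach [set u; w]).
Definition entangled u w := (pmass u w < mass u) && (pmass w u < mass w).

Lemma entangledC u w : entangled u w = entangled w u.
Proof. by rewrite /entangled andbC. Qed.

Lemma notin1 x : x != ord0 -> ord0 \notin [set x].
Proof. by rewrite inE eq_sym. Qed.

Lemma notin2 x y : x != ord0 -> y != ord0 -> ord0 \notin [set x; y].
Proof. by rewrite !inE negb_or ![ord0 == _]eq_sym => -> ->. Qed.

Lemma reach1_self u : u != ord0 -> u \notin reach [set u].
Proof. by move=> u0; apply/negP => /(reach_notin (notin1 u0)); rewrite inE eqxx. Qed.

Lemma reach2_self u w : u != ord0 -> w != ord0 ->
  (u \notin reach [set u; w]) * (w \notin reach [set u; w]).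
Proof.
move=> u0 w0.
by split; apply/negP => /(reach_notin (notin2 u0 w0)); rewrite !inE eqxx ?orbT.
Qed.

Lemma reach1_step u x y : u != ord0 ->
  x \in reach [set u] -> adj G x y -> y != u -> y \in reach [set u].
Proof. by move=> u0 Rx xy yu; apply: reach_step Rx xy _; rewrite ?notin1 ?inE. Qed.

Lemma reach2_step u w x y : u != ord0 -> w != ord0 ->
  x \in reach [set u; w] -> adj G x y -> y != u -> y != w -> y \in reach [set u; w].
Proof.
by move=> u0 w0 Rx xy yu yw; apply: reach_step Rx xy _; rewrite ?notin2 ?inE ?negb_or ?yu.
Qed.

Lemma reach2_l u w : u != ord0 -> w != ord0 -> reach [set u; w] \subset reach [set u].
Proof. by move=> u0 w0; apply: reachS; rewrite ?notin2 // sub1set !inE eqxx. Qed.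

Lemma reach2_r u w : u != ord0 -> w != ord0 -> reach [set u; w] \subset reach [set w].
Proof. by move=> u0 w0; apply: reachS; rewrite ?notin2 // sub1set !inE eqxx orbT. Qed.

Lemma reach2_entry u w : u != ord0 -> w != ord0 -> u \in reach [set w] ->
  exists2 t, t \in reach [set u; w] & adj G t u.
Proof. by move=> u0 w0 Ru; have [t] := reach_entry (notin1 w0) Ru u0; exists t. Qed.

Lemma leq_wdeg u S S' : S \subset S' -> wdeg u S <= wdeg u S'.
Proof. by move=> sSS'; rewrite /wdeg [X in _ <= X](big_setID S) (setIidPr sSS') leq_addr. Qed.

Lemma ltn_pmassP u w : u != ord0 -> w != ord0 ->
  reflect (exists z, [/\ adj G u z, z \in reach [set u] & z \notin reach [set u; w]])
          (pmass u w < mass u).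
Proof.
move=> u0 w0; have sub := reach2_l u0 w0.
rewrite /pmass /mass /wdeg [X in _ < X](big_setID (reach [set u; w])) /=.
rewrite (setIidPr sub) -[X in X < _]addn0 ltn_add2l lt0n sum_nat_eq0.
apply: (iffP forallPn) => [[z]|[z [uz Rz Rz']]].
  rewrite negb_imply inE -lt0n => /andP[/andP[Rz' Rz] uz].
  by exists z; split.
by exists z; rewrite negb_imply inE Rz Rz' -lt0n.
Qed.

Lemma mass_gt0 u : u != ord0 -> 0 < mass u.
Proof.
move=> u0; have [|t] := reach_entry _ (reach_set0 u) u0; first by rewrite inE.
rewrite setU0 => Rt tu; rewrite /mass /wdeg (bigD1 t) //=.
by rewrite adjC in tu; apply: leq_trans tu (leq_addr _ _).
Qed.

(** Deleting u already separates w from the root, so deleting w as well costs u nothing: [pmass u w]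
    equals [mass u]. *)
Lemma not_entangled_dom u w : u != ord0 -> w != ord0 -> w \notin reach [set u] ->
  ~~ entangled u w.
Proof.
move=> u0 w0 Rw; rewrite negb_and; apply/orP; left; apply/ltn_pmassP => // -[z [_ Rz /negP[]]].
apply: (subsetP (reach_sub _ _)) Rz; first exact: notin2.
move=> x Rx; rewrite !inE negb_or; apply/andP; split.
  by apply: contraTneq Rx => ->; apply: reach1_self.
by apply: contraTneq Rx => ->.
Qed.

(** The edge itself is lost: each endpoint counts in the [mass] of the other but not in its
    [pmass]. *)
Lemma adj_entangled u w : u != ord0 -> w != ord0 -> adj G u w ->
  w \in reach [set u] -> u \in reach [set w] -> entangled u w.
Proof.
move=> u0 w0 uw Rw Ru; apply/andP; split; apply/ltn_pmassP => //.
  by exists w; rewrite uw Rw reach2_self.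
by exists u; rewrite adjC uw Ru reach2_self.
Qed.

Lemma entangled_neq u w : u != ord0 -> w != ord0 -> entangled u w -> u != w.
Proof.
move=> u0 w0 ent; apply: contraTneq ent => ->.
by apply: not_entangled_dom; rewrite ?reach1_self.
Qed.

(** If each vertex dominated the other, no edge could leave [reach [set u; w]], since it would lead
    to one of them while the other is still avoided. Connectedness would then put u itself in that
    set. *)
Lemma dominates_asym u w : u != ord0 -> w != ord0 -> u != w ->
  (w \in reach [set u]) || (u \in reach [set w]).
Proof.
move=> u0 w0 uw; apply: contraT; rewrite negb_or => /andP[Rw Ru].
suff all2 x : x \in reach [set u; w] by have:= all2 u; rewrite (negPf (reach2_self u0 w0).1).
move: x; apply: reach_closedT (reach0 _) _ => x y Rx xy.
have R1x := subsetP (reach2_l u0 w0) _ Rx; have R2x := subsetP (reach2_r u0 w0) _ Rx.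
have yu : y != u.
  by apply: contraNneq Ru => yu; rewrite -yu; apply: reach1_step R2x xy _; rewrite ?yu.
have yw : y != w.
  apply: contraNneq Rw => yw; rewrite -yw; apply: reach1_step R1x xy _; rewrite // yw eq_sym.
exact: reach2_step Rx xy yu yw.
Qed.

(* [w \notin reach [set x]] says that x dominates w: every path from the root to w meets x.
   Entangled vertices have the same dominators. *)
Lemma entangled_dom x w w' : x != ord0 -> w != ord0 -> w' != ord0 -> x != w -> x != w' ->
  entangled w w' -> w \notin reach [set x] -> w' \notin reach [set x].
Proof.
move=> x0 w0 w'0 xw xw' ent Rw; apply: contraL ent => Rw'.
have sub_x : {in reach [set x], forall s, s != w}.
  by move=> s Rs; apply: contraNneq Rw => <-.
have [Rx|Rx] := boolP (x \in reach [set w']); last first.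
  rewrite entangledC not_entangled_dom //; apply: contra Rw; apply/subsetP.
  by apply: reach_sub => [|s Rs]; rewrite ?notin1 // inE; apply: contraNneq Rx => <-.
rewrite negb_and; apply/orP; left; apply/ltn_pmassP => // -[z [wz Rz /negP[]]].
have Rxw : x \in reach [set w; w'].
  have [t Rt tx] := reach2_entry x0 w'0 Rx.
  have w'x : w' != x by rewrite eq_sym.
  apply: (reach2_step w0 w'0 _ tx) => //.
  apply: (subsetP (reach_sub _ _)) Rt => [|s Rs]; rewrite ?notin2 // !inE negb_or.
  rewrite sub_x ?(subsetP (reach2_l x0 w'0)) //=.
  by apply: contraTneq Rs => ->; case: (reach2_self x0 w'0).
(* Whatever the root reaches without w, it also reaches without meeting w' as well, or without x: a
   step onto x lands in the first set, a step onto w' in the second. *)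
suff sub : {subset reach [set w] <= [pred s | (s \in reach [set w; w']) || (s \in reach [set x])]}.
  case/orP: (sub z Rz) => // Rxz; case/negP: Rw.
  by apply: reach1_step Rxz _ _; rewrite 1?adjC // eq_sym.
apply: reach_ind => [|s t Rs Kst sw tw st]; first by rewrite inE reach0.
rewrite inE in tw; rewrite inE; have [->|tx] := eqVneq t x; first by rewrite Rxw.
case/orP: Kst => Ks; last by rewrite (reach1_step x0 Ks st) ?orbT.
have [->|tw'] := eqVneq t w'; first by rewrite Rw' orbT.
by rewrite (reach2_step w0 w'0 Ks st).
Qed.

(* Two such neighbours of v would dominate each other. *)
Lemma unique_parent v x y : v != ord0 -> adj G v x -> adj G v y ->
  (x != ord0 -> v \notin reach [set x]) -> (y != ord0 -> v \notin reach [set y]) ->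
  x = y.
Proof.
move=> v0 vx vy domx domy; apply/eqP; apply: contraT => xy.
have notRv u u' : u != ord0 -> v \notin reach [set u] -> adj G v u -> adj G v u' ->
    u' \notin reach [set u].
  move=> u0 Ru vu vu'; apply: contra Ru => Ru'.
  by apply: reach1_step Ru' _ (adj_neq vu); rewrite // adjC.
have [x0|x0] := eqVneq x ord0.
  have y0 : y != ord0 by rewrite -x0 eq_sym.
  by have:= notRv y x y0 (domy y0) vy vx; rewrite x0 reach0.
have [y0|y0] := eqVneq y ord0.
  by have:= notRv x y x0 (domx x0) vx vy; rewrite y0 reach0.
have:= dominates_asym x0 y0 xy.
by rewrite (negPf (notRv _ _ x0 (domx x0) vx vy)) (negPf (notRv _ _ y0 (domy y0) vy vx)).
Qed.

Lemma adj_dominates x y : x != ord0 -> y != ord0 -> adj G x y -> ~~ entangled x y ->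
  x \in reach [set y] -> y \notin reach [set x].
Proof. by move=> x0 y0 xy nent Rx; apply: contra nent => Ry; apply: adj_entangled. Qed.

(** Every neighbour of y in [reach [set y]] other than the root dominates y, so [unique_parent]
    leaves x alone there and its edge carries the whole mass of y. *)
Lemma wt_parent x y : y != ord0 ->
  (forall z, z != ord0 -> z != y -> ~~ entangled z y) ->
  adj G x y -> x \in reach [set y] -> wt G x y = mass y.
Proof.
move=> y0 nent xy Rx; have dom z : adj G y z -> z \in reach [set y] ->
    z != ord0 -> y \notin reach [set z].
  move=> yz Rz z0; apply: adj_dominates => //; first by rewrite adjC.
  by rewrite nent // eq_sym adj_neq.
rewrite /mass /wdeg (bigD1 x) //= big1 ?addn0 1?wt_sym // => z /andP[Rz].
apply: contraNeq; rewrite -lt0n => yz.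
have yx : adj G y x by rewrite adjC.
by apply/eqP; apply: (unique_parent y0 yz yx); apply: dom.
Qed.

(** The exchange step behind the extremal choices below: trading w for a vertex z that {u, w} cuts
    off frees w itself, so strictly less is cut off. *)
Lemma reach2_grow u w z : u != ord0 -> w != ord0 -> z != ord0 -> u != w -> z != w ->
  w \in reach [set u] -> z \notin reach [set u; w] ->
  w \in reach [set u; z] /\ reach [set u; w] \proper reach [set u; z].
Proof.
move=> u0 w0 z0 uw zw Rw Rz.
have sub : reach [set u; w] \subset reach [set u; z].
  apply: reach_sub; first exact: notin2.
  move=> x Rx; rewrite in_set2 negb_or; apply/andP; split.
    by apply: contraTneq Rx => ->; rewrite (reach2_self u0 w0).1.
  by apply: contraTneq Rx => ->.
have Rwz : w \in reach [set u; z].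
  have [t Rt tw] := reach2_entry w0 u0 Rw; rewrite setUC in Rt.
  by apply: (reach2_step u0 z0 (subsetP sub _ Rt) tw); rewrite eq_sym.
split=> //; rewrite properE sub; apply/subsetPn; exists w => //.
by rewrite (reach2_self u0 w0).2.
Qed.

Lemma leq_wdeg_adj u S S' : (forall z, z \in S -> adj G u z -> z \in S') ->
  wdeg u S <= wdeg u S'.
Proof.
move=> sub; apply: leq_trans (leq_wdeg u (subsetIr S S')).
rewrite /wdeg (big_setID S') /= [X in _ + X <= _]big1 ?addn0 // => z /setDP[Sz S'z].
by apply/eqP; apply: contraNT S'z; rewrite -lt0n; apply: sub.
Qed.

(** If w lay outside the component C of u in the graph without its root, deleting w besides u would
    not change which vertices of C the root reaches, and u would lose no mass. *)
Lemma entangled_connect u w : u != ord0 -> w != ord0 -> entangled u w ->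
  connect (induced (adj G) (~: [set ord0])) u w.
Proof.
move=> u0 w0 /andP[/(ltn_pmassP u0 w0)[z [uz Rz Rz']] _].
pose C := [set x | connect (induced (adj G) (~: [set ord0])) u x].
rewrite -[connect _ _ _](in_set (connect _ u)) -/C.
apply: contraR Rz' => Cw; pose K := [pred x | (x \in reach [set u; w]) || (x \notin C)].
have stepC x y : x \in C -> x != ord0 -> y != ord0 -> adj G x y -> y \in C.
  rewrite !in_set => Cx x0 y0 xy; apply: connect_trans Cx (connect1 _).
  by rewrite inducedE !in_setC !in_set1 x0 y0.
suff sub : {subset reach [set u] <= K}.
  have [->|z0] := eqVneq z ord0; first exact: reach0.
  case/orP: (sub z Rz) => // /negP[]; apply: stepC uz; rewrite // in_set.
  exact: connect0.
apply: reach_ind => [|x y Rx Kx xu yu xy]; first by rewrite inE reach0.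
rewrite inE; have [Cy|Cy] := boolP (y \in C); rewrite ?orbT // orbF.
rewrite in_set1 in yu; have yw : y != w by apply: contraNneq Cw => <-.
case/orP: Kx => [R2x|Cx]; first exact: (reach2_step u0 w0 R2x xy).
have [y0|y0] := eqVneq y ord0; first by rewrite y0 reach0.
have [x0|x0] := eqVneq x ord0.
  by apply: (reach2_step u0 w0 (reach0 _) _ yu yw); rewrite -x0.
by case/negP: Cx; apply: stepC Cy y0 x0 _; rewrite adjC.
Qed.

Lemma dominates_reach x y : x != ord0 -> y != ord0 -> x != y -> y \notin reach [set x] ->
  reach [set x] \proper reach [set y].
Proof.
move=> x0 y0 xy Ry; rewrite properE; apply/andP; split.
  by apply: reach_sub => [|s Rs]; rewrite ?notin1 // inE; apply: contraNneq Ry => <-.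
apply/subsetPn; exists x; rewrite ?reach1_self //.
by have:= dominates_asym x0 y0 xy; rewrite (negPf Ry).
Qed.

(** On a cycle, take the non-root vertex v with the largest reached set. It dominates neither of its
    neighbours on the cycle, so those that are not the root dominate v, and [unique_parent]
    identifies them. *)
Lemma acyclic_unentangled S :
  {in S &, forall x y, x != ord0 -> y != ord0 -> ~~ entangled x y} ->
  acyclic_on (adj G) S.
Proof.
move=> nent c /andP[cyc_c uniq_c]; rewrite ltnNge; apply/negP => sz.
have c_edge x : x \in c -> [/\ x \in S, next c x \in S & adj G x (next c x)].
  by move=> cx; have /and3P[] := next_cycle cyc_c cx.
have [v0 cv0 v00] : exists2 v, v \in c & v != ord0.
  case: c uniq_c sz {cyc_c c_edge} => [|x [|y c]] //= /andP[/norP[xy _] _] _.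
  have [x0|x0] := eqVneq x ord0; last by exists x; rewrite ?inE ?eqxx.
  by exists y; rewrite ?inE ?eqxx ?orbT // -x0 eq_sym.
pose P := [pred v | (v \in c) && (v != ord0)].
case: (@arg_maxnP _ v0 P (fun v => #|reach [set v]|)) => [|v /andP[cv v0' ] max_v].
  by rewrite /= cv0.
have [Sv Snv vn] := c_edge v cv; have cp : prev c v \in c by rewrite mem_prev.
have [Sp _] := c_edge _ cp; rewrite (next_prev uniq_c) adjC => vp.
have dom y : y \in c -> y \in S -> adj G v y -> y != ord0 -> v \notin reach [set y].
  move=> cy Sy vy y0; apply: adj_dominates => //; rewrite 1?adjC //; first exact: nent.
  apply: contraT => /(dominates_reach v0' y0 (adj_neq vy))/proper_card.
  by rewrite ltnNge => /negP[]; apply: max_v; rewrite /= cy.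
have cn : next c v \in c by rewrite mem_next.
have E := unique_parent v0' vn vp (dom _ cn Snv vn) (dom _ cp Sp vp).
by have:= next_neq_prev uniq_c sz cv; rewrite E eqxx.
Qed.

End Reach.

(** * Parking functions supported on two vertices *)

Section Parking.
Variables (n : nat) (G : rooted_graph n).
Local Notation V := 'I_n.+1.
Implicit Types (u v w x y z : V) (U S : {set V}) (f : V -> nat).

(** Parking functions as functions on all vertices, the value at the root being ignored;
    transpositions of vertices then act by composition. *)
Definition vparking f : Prop :=
  forall U, ord0 \notin U -> U != set0 -> exists2 i, i \in U & f i < wdeg G i (~: U).

Lemma outdegE U i : outdeg G U i = wdeg G i (~: U).
Proof. by apply: eq_bigl => j; rewrite in_setC. Qed.

Lemma vparkingP b f : (forall k, b k = f (lift ord0 k)) -> (parking G b <-> vparking f).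
Proof.
move=> bf; split=> park U.
  move=> U0 /set0Pn[v Uv].
  have defU : lift ord0 @: (lift ord0 @^-1: U) = U.
    apply/setP => z; apply/imsetP/idP => [[k Uk ->]|Uz]; first by rewrite inE in Uk.
    have /unlift_some[k zk _] : ord0 != z by apply: contraNneq U0 => ->.
    by exists k; rewrite // inE -zk.
  case: (park (lift ord0 @^-1: U)) => [|k]; last first.
    rewrite defU inE outdegE bf => Uk lt_k.
    by exists (lift ord0 k).
  apply: contraTneq Uv => U'0; rewrite -defU U'0; apply/imsetP => -[k].
  by rewrite inE.
move=> /set0Pn[k Uk]; case: (park (lift ord0 @: U)) => [||i /imsetP[j Uj ->] lt_j].
- by apply/imsetP => -[j _ /eqP]; rewrite (negPf (neq_lift _ _)).
- by apply/set0Pn; exists (lift ord0 k); apply: imset_f.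
by exists j; rewrite // outdegE bf.
Qed.

Lemma wdeg_ltn u S S' k : k < wdeg G u S -> S \subset S' -> k < wdeg G u S'.
Proof. by move=> lt_k /(leq_wdeg G u); apply: leq_trans. Qed.

Lemma wdeg_gt0 u S : reflect (exists2 z, z \in S & adj G u z) (0 < wdeg G u S).
Proof.
rewrite lt0n sum_nat_eq0; apply: (iffP forallPn) => [[z]|[z Sz uz]].
  by rewrite negb_imply -lt0n => /andP[Sz uz]; exists z.
by exists z; rewrite negb_imply Sz -lt0n.
Qed.

(** The L-shaped region: one of the two values is small enough to burn from the vertices reached
    while avoiding both, after which the other only has to stay below its mass. *)
Definition burnt_pair u w (k l : nat) :=
  (k < pmass G u w) && (l < mass G w) || (l < pmass G w u) && (k < mass G u).

(* Dhar's burning algorithm for a function supported on at most two vertices *)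
Lemma vparking_pair u w f : u != ord0 -> w != ord0 ->
  (forall z, z != u -> z != w -> f z = 0) ->
  (vparking f <-> burnt_pair u w (f u) (f w)).
Proof.
move=> u0 w0 f0; split=> [park|].
  (* A vertex outside the reached set with a neighbour in it can only be u or w; the one found here
     burns first. *)
  have [i Ri lt_i] : exists2 i, i \in ~: reach G [set u; w] & f i < wdeg G i (reach G [set u; w]).
    rewrite -{2}[reach _ _]setCK; apply: park; first by rewrite in_setC reach0.
    by apply/set0Pn; exists u; rewrite in_setC reach2_self.
  have lt_mass z : z != ord0 -> (forall y, y \notin [set u; w] -> f y = 0) ->
      z \in [set u; w] -> f z < mass G z.
    move=> z0 f0' zuw.
    have [j Rj lt_j] : exists2 i, i \in ~: reach G [set z] & f i < wdeg G i (reach G [set z]).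
      rewrite -{2}[reach _ _]setCK; apply: park; first by rewrite in_setC reach0.
      by apply/set0Pn; exists z; rewrite in_setC reach1_self.
    suff /eqP def_j : j == z by rewrite def_j in lt_j.
    have /wdeg_gt0[t Rt jt] := leq_ltn_trans (leq0n _) lt_j.
    rewrite in_setC in Rj; apply: contraNT Rj => jz.
    by apply: (reach1_step z0 Rt _ jz); rewrite adjC.
  have f0' y : y \notin [set u; w] -> f y = 0 by rewrite !inE negb_or => /andP[]; apply: f0.
  have /wdeg_gt0[t Rt it] := leq_ltn_trans (leq0n _) lt_i.
  have : i \in [set u; w].
    rewrite in_setC in Ri; apply: contraNT Ri; rewrite in_set2 negb_or => /andP[iu iw].
    by apply: (reach2_step u0 w0 Rt _ iu iw); rewrite adjC.
  rewrite !inE => /orP[] /eqP def_i; rewrite def_i in lt_i.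
    by rewrite /burnt_pair lt_i lt_mass // set22.
  by rewrite /burnt_pair /pmass orbC (setUC [set w]) lt_i lt_mass // set21.
wlog: u w u0 w0 f0 / (f u < pmass G u w) && (f w < mass G w) => [IH|].
  case/orP=> lt_uw; first by apply: (IH u w); rewrite // /burnt_pair lt_uw.
  by apply: (IH w u); rewrite // /burnt_pair 1?lt_uw // => z zw zu; apply: f0.
move=> /andP[lt_u lt_w] _ U U0 /set0Pn[v Uv].
(* If [U] meets [reach G S] only in vertices other than u and w, one of them has value 0 and a
   neighbour outside [U]. *)
have burn S i : i \in U -> i \in reach G S -> (u \in U -> u \notin reach G S) ->
    (w \in U -> w \notin reach G S) -> exists2 i, i \in U & f i < wdeg G i (~: U).
  move=> Ui Ri Ru Rw; have [i' [j [Ui' Ri' Rj Uj i'j]]] := reach_exit U0 Ui Ri.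
  exists i' => //; rewrite f0.
  - by apply/wdeg_gt0; exists j; rewrite ?in_setC.
  - by apply: contraTneq Ri' => def_i'; rewrite def_i' Ru // -def_i'.
  by apply: contraTneq Ri' => def_i'; rewrite def_i' Rw // -def_i'.
have sub_compl S : [disjoint U & reach G S] -> reach G S \subset ~: U.
  by rewrite disjoint_sym disjoints_subset.
have [/sub_compl dis|/pred0Pn[i /andP[Ui Ri]]] :=
  boolP [disjoint U & reach G [set u; w]]; last first.
  by apply: burn Ui Ri _ _ => _; rewrite reach2_self.
have [Uu|Uu] := boolP (u \in U); first by exists u => //; apply: wdeg_ltn lt_u dis.
have [/sub_compl dis1|/pred0Pn[i /andP[Ui Ri]]] := boolP [disjoint U & reach G [set w]]; last first.
  by apply: burn Ui Ri _ _ => [|_]; rewrite ?reach1_self // (negPf Uu).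
have [Uw|Uw] := boolP (w \in U); first by exists w => //; apply: wdeg_ltn lt_w dis1.
by apply: burn Uv (reach_set0 G v) _ _; rewrite ?(negPf Uu) ?(negPf Uw).
Qed.

(** * Quantities preserved by transpositions inside a side *)

Definition swap_invariant (X : {set V}) : Prop :=
  forall a b f, a \in X -> b \in X -> vparking f -> vparking (f \o tperm a b).

Section SwapInvariant.
Variable X : {set V}.
Hypotheses (X0 : ord0 \notin X) (invX : swap_invariant X).

Lemma tperm_neq0 a b u : a \in X -> b \in X -> u != ord0 -> tperm a b u != ord0.
Proof.
move=> Xa Xb u0; case: tpermP => // _.
  by apply: contraNneq X0 => <-.
by apply: contraNneq X0 => <-.
Qed.

(** The condition [u = w -> k = l] keeps the function with values k at u and l at w well defined on
    the diagonal; that case yields the invariance of [mass]. *)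
Lemma burnt_pair_tperm a b u w k l : a \in X -> b \in X -> u != ord0 -> w != ord0 ->
  (u = w -> k = l) ->
  burnt_pair (tperm a b u) (tperm a b w) k l = burnt_pair u w k l.
Proof.
move=> Xa Xb; have imp v z : v != ord0 -> z != ord0 -> (v = z -> k = l) ->
    burnt_pair v z k l -> burnt_pair (tperm a b v) (tperm a b z) k l.
  move=> v0 z0 E; pose f y := if y == v then k else if y == z then l else 0.
  have fv : f v = k by rewrite /f eqxx.
  have fz : f z = l by rewrite /f eqxx; case: eqP => // zv; rewrite E.
  have: vparking f <-> burnt_pair v z k l.
    by rewrite -fv -fz; apply: vparking_pair => // y; rewrite /f => /negPf-> /negPf->.
  move=> [_ park] /park/(invX Xa Xb) park'.
  have := iffLR (vparking_pair (tperm_neq0 Xa Xb v0) (tperm_neq0 Xa Xb z0) _) park'.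
  rewrite /= !tpermK fv fz; apply=> y yv yz.
  rewrite /f -{1}(tpermK a b v) -{1}(tpermK a b z) !(inj_eq perm_inj).
  by rewrite (negPf yv) (negPf yz).
move=> u0 w0 E; apply/idP/idP; last exact: imp.
move/imp; rewrite !tpermK; apply; rewrite ?tperm_neq0 //.
by move=> eq_uw; apply: E; apply: perm_inj eq_uw.
Qed.

Lemma mass_tperm a b u : a \in X -> b \in X -> u != ord0 ->
  mass G (tperm a b u) = mass G u.
Proof.
move=> Xa Xb u0; have E k := @burnt_pair_tperm a b u u k k Xa Xb u0 u0 (fun _ => erefl).
have burntE z k : burnt_pair z z k k = (k < mass G z).
  by rewrite /burnt_pair /pmass setUid orbb andbb.
apply/eqP; rewrite eqn_leq; apply/andP; split; rewrite leqNgt; apply/negP.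
  by rewrite -burntE E burntE ltnn.
by rewrite -burntE -E burntE ltnn.
Qed.

(** The L-shaped region fills its bounding box exactly when it contains the far corner. *)
Lemma entangled_burnt u w : u != ord0 -> w != ord0 ->
  entangled G u w = ~~ burnt_pair u w (mass G u).-1 (mass G w).-1.
Proof.
move=> u0 w0; rewrite /burnt_pair !prednK ?mass_gt0 // !leqnn !andbT.
by rewrite negb_or -!ltnNge.
Qed.

Lemma entangled_tperm a b u w : a \in X -> b \in X -> u != ord0 -> w != ord0 -> u != w ->
  entangled G (tperm a b u) (tperm a b w) = entangled G u w.
Proof.
move=> Xa Xb u0 w0 uw; rewrite !entangled_burnt ?tperm_neq0 // !mass_tperm //.
by rewrite burnt_pair_tperm //; move/eqP: uw.
Qed.

(** For an entangled pair, giving w its largest value prevents it from burning first, so the values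
    allowed at u are exactly those below [pmass G u w]. *)
Lemma pmass_tperm a b u w : a \in X -> b \in X -> u != ord0 -> w != ord0 -> u != w ->
  entangled G u w -> pmass G (tperm a b u) (tperm a b w) = pmass G u w.
Proof.
move=> Xa Xb u0 w0 uw ent.
have burntE u' w' k : u' != ord0 -> w' != ord0 -> entangled G u' w' ->
    burnt_pair u' w' k (mass G w').-1 = (k < pmass G u' w').
  move=> u'0 w'0 /andP[_ lt]; rewrite /burnt_pair !prednK ?mass_gt0 // leqnn andbT.
  by rewrite (leqNgt (mass G w')) lt orbF.
have E k : (k < pmass G (tperm a b u) (tperm a b w)) = (k < pmass G u w).
  rewrite -!burntE ?tperm_neq0 ?entangled_tperm // mass_tperm // burnt_pair_tperm //.
  by move/eqP: uw.
by apply/eqP; rewrite eqn_leq; apply/andP; split; rewrite leqNgt ?E ?ltnn // -E ltnn.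
Qed.

Lemma mass_const u u' : u \in X -> u' \in X -> mass G u = mass G u'.
Proof.
move=> Xu Xu'; rewrite -{1}(tpermR u u') mass_tperm //.
by apply: contraNneq X0 => <-.
Qed.

Lemma side_mem_neq0 u : u \in X -> u != ord0.
Proof. by apply: contraTneq => ->. Qed.

Lemma entangled_constl u u' w : u \in X -> u' \in X -> w \notin X -> w != ord0 ->
  entangled G u w = entangled G u' w.
Proof.
move=> Xu Xu' Xw w0.
have neq_w v : v \in X -> v != w by move=> Xv; apply: contraNneq Xw => <-.
have:= @entangled_tperm u u' u w Xu Xu' (side_mem_neq0 Xu) w0 (neq_w u Xu).
by rewrite tpermL tpermD ?neq_w.
Qed.

Lemma pair_perm u w u' w' : u \in X -> w \in X -> u' \in X -> w' \in X ->
  u != w -> u' != w' ->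
  entangled G u w = entangled G u' w' /\
  (entangled G u w -> pmass G u w = pmass G u' w').
Proof.
(* Two transpositions carry (u, w) to (u', w'): the first sends u to u' and w to [w1], the second
   sends [w1] to w' and fixes u'. *)
move=> Xu Xw Xu' Xw' uw uw'; pose w1 := tperm u u' w.
have Xw1 : w1 \in X by rewrite /w1; case: tpermP.
have u'w1 : u' != w1 by rewrite -[X in X != _](tpermL u u') (inj_eq perm_inj).
have E1 := @entangled_tperm u u' u w Xu Xu' (side_mem_neq0 Xu) (side_mem_neq0 Xw) uw.
have E2 := @entangled_tperm w1 w' u' w1 Xw1 Xw' (side_mem_neq0 Xu') (side_mem_neq0 Xw1) u'w1.
have F1 := @pmass_tperm u u' u w Xu Xu' (side_mem_neq0 Xu) (side_mem_neq0 Xw) uw.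
have F2 := @pmass_tperm w1 w' u' w1 Xw1 Xw' (side_mem_neq0 Xu') (side_mem_neq0 Xw1) u'w1.
rewrite tpermL -/w1 in E1 F1; rewrite tpermL (@tpermD _ w1 w' u') // in E2 F2;
  try by rewrite eq_sym.
by split=> [|ent]; [rewrite E2 E1 | rewrite F2 ?E1 ?F1].
Qed.

End SwapInvariant.
End Parking.

(** * From block permutations to transpositions of vertices *)

Section TypeII.
Variables (p q : nat) (G : rooted_graph (p + q)).
Local Notation V := 'I_(p + q).+1.

Lemma AsetP (v : V) : reflect (exists i : 'I_p, v = lift ord0 (lshift q i)) (v \in Aset p q).
Proof.
rewrite inE; apply: (iffP andP) => [[v0 vp]|[i ->]]; last by rewrite /= /bump add1n ltn_ord.
have lt_v : v.-1 < p by rewrite prednK.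
by exists (Ordinal lt_v); apply: val_inj; rewrite /= /bump add1n prednK.
Qed.

Lemma BsetP (v : V) : reflect (exists j : 'I_q, v = lift ord0 (rshift p j)) (v \in Bset p q).
Proof.
rewrite inE; apply: (iffP idP) => [vp|[i ->]]; last by rewrite /= /bump add1n ltnS leq_addr.
have lt_v : v - p.+1 < q by rewrite ltn_subLR // addSn (ltn_ord v).
by exists (Ordinal lt_v); apply: val_inj; apply/esym/(subnKC vp).
Qed.

Lemma Aset0 : ord0 \notin Aset p q. Proof. by rewrite inE. Qed.
Lemma Bset0 : ord0 \notin Bset p q. Proof. by rewrite inE. Qed.

Lemma in_AB (v : V) : v != ord0 -> (v \in Bset p q) = (v \notin Aset p q).
Proof. by rewrite -lt0n !inE => ->; rewrite -ltnNge. Qed.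

Hypothesis invG : forall (s : 'S_p) (t : 'S_q) (b : 'I_(p + q) -> nat),
  parking G b -> parking G (permute_blocks s t b).

Lemma swap_invariant_blocks (s : 'S_p) (t : 'S_q) f f' :
  (forall i, f' (lift ord0 (lshift q i)) = f (lift ord0 (lshift q (s i)))) ->
  (forall j, f' (lift ord0 (rshift p j)) = f (lift ord0 (rshift p (t j)))) ->
  vparking G f -> vparking G f'.
Proof.
move=> fs ft; pose b k := f (lift ord0 k).
have [_ parkf] := vparkingP G (fun k => erefl (b k)) => /parkf/(invG s t) park'.
apply: (iffLR (vparkingP _ _) park') => k.
rewrite -[k]splitK /permute_blocks; case: (split k) => i; rewrite unsplitK /=.
  by rewrite fs.
by rewrite ft.
Qed.

Lemma swap_invariantA : swap_invariant G (Aset p q).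
Proof.
move=> _ _ f /AsetP[i ->] /AsetP[i' ->].
apply: (@swap_invariant_blocks (tperm i i') 1) => k /=.
  have inj_v : injective (fun i : 'I_p => lift ord0 (lshift q i) : V).
    by move=> j j' /lift_inj/lshift_inj.
  by rewrite (inj_tperm _ _ _ inj_v).
by rewrite perm1 tpermD // (inj_eq lift_inj) eq_lrshift.
Qed.

Lemma swap_invariantB : swap_invariant G (Bset p q).
Proof.
move=> _ _ f /BsetP[i ->] /BsetP[i' ->].
apply: (@swap_invariant_blocks 1 (tperm i i')) => k /=.
  by rewrite perm1 tpermD // (inj_eq lift_inj) eq_rlshift.
have inj_v : injective (fun i : 'I_q => lift ord0 (rshift p i) : V).
  by move=> j j' /lift_inj/rshift_inj.
by rewrite (inj_tperm _ _ _ inj_v).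
Qed.

End TypeII.

(** * Cycles from degrees *)

Lemma maximal_path (T : finType) (e : rel T) (Y : {set T}) i s :
  uniq (i :: s) -> path e i s -> {subset s <= Y} ->
  exists t, [/\ uniq (i :: t), path e i t, {subset t <= Y}, size s <= size t
    & forall y, y \in Y -> e (last i t) y -> y \in i :: t].
Proof.
have [k] := ubnP (#|T| - size s); elim: k s => // k IHk s lt_k uniq_s path_s sY.
have [/existsP[y /and3P[Yy sy ey]]|] :=
  boolP [exists y, [&& y \in Y, y \notin i :: s & e (last i s) y]].
  have uniq_sy : uniq (i :: rcons s y) by rewrite -rcons_cons rcons_uniq sy.
  have := card_uniqP uniq_sy; rewrite /= size_rcons => card_sy.
  have le_sy := max_card [in i :: rcons s y]; rewrite card_sy in le_sy.
  case: (IHk (rcons s y)) => // [|||t [uniq_t path_t tY le_t max_t]].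
  - by rewrite size_rcons subnS -ltnS prednK // subn_gt0 ltnW.
  - by rewrite rcons_path path_s.
  - by move=> z; rewrite mem_rcons inE => /predU1P[->|/sY].
  by exists t; split=> //; apply: leq_trans le_t; rewrite size_rcons.
move/existsPn=> max_s; exists s; split=> // y Yy ey.
by have:= max_s y; rewrite Yy ey andbT negbK.
Qed.

(* A longest path starting at i must close up at i, since each of its inner vertices has
   already used up its two neighbours. *)
Lemma cycle_of_degree2 (T : finType) (e : rel T) (i : T) (Y : {set T}) :
  symmetric e -> irreflexive e -> i \notin Y ->
  {in Y, forall y, #|[set z in i |: Y | e y z]| = 2} ->
  connected_on e Y -> (exists2 w, w \in Y & e i w) ->
  exists c, [/\ uniq c, 2 < size c, c =i i |: Y
    & {in i |: Y &, forall x y, e x y = (y == next c x) || (x == next c y)}].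
Proof.
move=> symE irrE Yi deg2 connY [w Yw iw].
case: (@maximal_path T e Y i [:: w]) => [|||s [uniq_c path_s sY sz_s max_s]].
- by rewrite /= inE andbT; apply: contraNneq Yi => ->.
- by rewrite /= iw.
- by move=> z; rewrite inE => /eqP->.
pose c := i :: s; pose m := size s; pose a k := nth i c k.
have a_inj j k : j <= m -> k <= m -> (a j == a k) = (j == k) by move=> *; apply: nth_uniq.
have edge k : k < m -> e (a k) (a k.+1) by move/pathP: path_s; apply.
have aS k : 0 < k <= m -> a k \in s by case: k => //= k lt_k; apply: mem_nth.
have aY k : 0 < k <= m -> a k \in Y by move/aS/sY.
have acY k : k <= m -> a k \in i |: Y.
  by case: k => [|k] le_k; rewrite ?setU11 // setU1r ?aY.
have memP z : z \in i |: Y -> z \in c -> exists2 k, k <= m & z = a k.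
  by move=> _ cz; exists (index z c); rewrite ?[a _]nth_index // -ltnS -[m.+1]/(size c) index_mem.
have nb_mid k z : 0 < k < m -> z \in i |: Y -> e (a k) z = (z == a k.-1) || (z == a k.+1).
  move=> /andP[k0 km] Yz; suff /setP/(_ z) : [set a k.-1; a k.+1] = [set z in i |: Y | e (a k) z].
    by rewrite in_set2 in_set Yz.
  have Yk : a k \in Y by rewrite aY // k0 ltnW.
  have le_k1 : k.-1 <= m := leq_trans (leq_pred k) (ltnW km).
  have neq_k : k.-1 == k.+1 = false by rewrite ltn_eqF // ltnS leq_pred.
  apply/eqP; rewrite eqEcard (deg2 _ Yk) cards2 a_inj // neq_k andbT.
  apply/subsetP => y /set2P[]->; rewrite in_set acY ?edge //=.
    by rewrite symE -{2}(prednK k0) edge // prednK // ltnW.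
(* By maximality the neighbours of the last vertex lie on the path, and an inner vertex not next to
   it has already used both of its neighbours. *)
have nb_last_sub : [set z in i |: Y | e (a m) z] \subset [set a m.-1; i].
  apply/subsetP => z; rewrite in_set => /andP[Yz ez].
  have cz : z \in c.
    case/setU1P: Yz => [->|Yz]; first by rewrite mem_head.
    apply: max_s => //; rewrite (last_nth i); exact: ez.
  have [k le_k def_z] := memP z Yz cz; rewrite def_z in ez *.
  case: k le_k ez {def_z cz Yz} => [|k] le_k; first by rewrite set22.
  have [->|km] := eqVneq k.+1 m; first by rewrite irrE.
  have lt_k : k.+1 < m by rewrite ltn_neqAle km.
  rewrite symE nb_mid ?acY // !a_inj //; last by rewrite ltnW // ltnW.
  case/orP=> /eqP /= def_m; first by rewrite def_m ltnn in le_k.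
  by rewrite def_m /= set21.
have m0 : 0 < m by [].
have /eqP nb_last : [set z in i |: Y | e (a m) z] == [set a m.-1; i].
  have Ym : a m \in Y by rewrite aY // m0 leqnn.
  rewrite eqEcard nb_last_sub (deg2 _ Ym) cards2.
  by case: (_ != _).
(* For m = 1 the two neighbours [a m.-1] and i of the last vertex would coincide. *)
have m1 : 1 < m.
  rewrite ltn_neqAle m0 andbT; apply/eqP => def_m.
  have := deg2 (a m); rewrite nb_last -def_m /= setUid cards1 => H.
  by have := H (aY 1 _); rewrite -def_m => /(_ isT).
(* At k = m the index is past the end of s, and the default i of [nth] is the successor that closes
   the cycle. *)
have nbE k z : 0 < k <= m -> z \in i |: Y ->
    e (a k) z = (z == a k.-1) || (z == nth i s k).
  move=> /andP[k0 km] Yz; have [def_k|nkm] := eqVneq k m; last first.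
    by rewrite nb_mid // k0 ltn_neqAle nkm.
  rewrite def_k [nth i s m]nth_default //.
  by have /setP/(_ z) := nb_last; rewrite in_set2 in_set Yz.
have nextE k : k <= m -> next c (a k) = nth i s k.
  move=> le_k; rewrite next_nth (_ : a k \in c); last exact: mem_nth.
  by rewrite /c /a -/c index_uniq.
have covY y : y \in Y -> y \in c.
  move=> Yy; have Y1 := aY 1 m0.
  pose K := [pred z | (z \in c) && (z \in Y)].
  suff /andP[] : y \in K by [].
  have conn : connect (induced e Y) (a 1) y by apply: connY.
  apply: (connect_stable (K := K) _ conn); last by rewrite inE Y1 inE aS ?m0 ?orbT.
  move=> u v /andP[cu Yu] /and3P[_ Yv uv]; rewrite inE Yv andbT.
  have [[|k] le_k def_u] := memP u (setU1r i Yu) cu; first by rewrite def_u (negPf Yi) in Yu.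
  move: uv; rewrite def_u nbE ?setU1r //= => /orP[] /eqP->.
    by apply: mem_nth; rewrite ltnS ltnW.
  have [lt_k|ge_k] := ltnP k.+1 m; first by rewrite inE mem_nth ?orbT.
  by rewrite nth_default ?mem_head.
have mem_c : c =i i |: Y.
  move=> z; rewrite in_setU1; have [->|zi] := eqVneq z i; first by rewrite mem_head.
  apply/idP/idP => [|/covY //]; by rewrite inE (negPf zi) => /sY.
have half x y : x \in Y -> y \in i |: Y -> e x y = (y == next c x) || (x == next c y).
  move=> Yx Yy; have [[|k] le_k def_x] := memP x (setU1r i Yx) (covY x Yx).
    by rewrite def_x (negPf Yi) in Yx.
  rewrite def_x nbE // nextE //= orbC; congr (_ || _).
  have -> : a k.+1 = next c (a k) by rewrite nextE // ltnW.
  by rewrite (inj_eq (can_inj (prev_next uniq_c))) eq_sym.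
exists c; split=> // x y; rewrite {1}in_setU1 => /predU1P[->|Yx]; last exact: half.
rewrite in_setU1 => /predU1P[->|Yy]; last by rewrite symE half ?setU11 // orbC.
rewrite irrE orbb; have -> : i = a 0 by [].
by rewrite nextE // -[nth i s 0]/(a 1) a_inj.
Qed.

(** * The side on which all pairs are entangled *)

Section EntangledNode.
Variables (n : nat) (G : rooted_graph n) (Y : {set 'I_n.+1}) (eps : nat).
Local Notation V := 'I_n.+1.
Implicit Types (S : {set V}) (u v w x y z : V).

Hypotheses (Y0 : ord0 \notin Y) (card_Y : 1 < #|Y|).
Hypothesis outer : forall x y, x != ord0 -> x \notin Y -> y \in Y -> ~~ entangled G x y.
Hypothesis inner : {in Y &, forall x y, x != y -> entangled G x y}.
Hypothesis mass_inner : {in Y &, forall x y, x != y -> mass G x = pmass G x y + eps}.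
Hypothesis mass_cst : {in Y &, forall x y, mass G x = mass G y}.

Lemma inner_neq0 y : y \in Y -> y != ord0.
Proof. by apply: contraTneq => ->. Qed.

(** The unentangled edge makes z dominate w, and [entangled_dom] spreads this to everything
    entangled with w, that is, to all of [Y]. *)
Lemma outer_dominates z w : z != ord0 -> z \notin Y -> w \in Y -> adj G z w ->
  z \in reach G [set w] -> forall y, y \in Y -> y \notin reach G [set z].
Proof.
move=> z0 Yz Yw zw Rz; have w0 := inner_neq0 Yw.
have Rw : w \notin reach G [set z] by apply: adj_dominates; rewrite ?outer.
move=> y Yy; have [<-//|wy] := eqVneq w y.
have zy : z != y by apply: contraNneq Yz => ->.
exact: (entangled_dom z0 w0 (inner_neq0 Yy) (adj_neq zw) zy (inner Yw Yy wy)).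
Qed.

Lemma reach_inner S : S \subset Y -> reach G Y \subset reach G S.
Proof. exact: reachS. Qed.

Lemma outer_reach z w : z \notin Y -> w \in Y -> adj G z w -> z \in reach G [set w] ->
  z \in reach G Y.
Proof.
move=> Yz Yw zw Rz; have [->|z0] := eqVneq z ord0; first exact: reach0.
have dom := outer_dominates z0 Yz Yw zw Rz.
have [|t] := reach_entry _ (reach_set0 G z) z0; first by rewrite inE.
rewrite setU0 => Rt tz; apply: reach_step Yz => //; last exact: tz.
by apply: (subsetP (reach_sub _ _)) Rt => // x Rx; apply: contraL Rx; apply: dom.
Qed.

(** A non-root gate dominates all of [Y], hence also any other gate, since [Y] could be entered from
    there. Two distinct gates would thus dominate each other, or one would dominate the root. *)
Lemma gate_unique z z' w w' : z \in reach G Y -> z' \in reach G Y -> w \in Y -> w' \in Y ->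
  adj G z w -> adj G z' w' -> z = z'.
Proof.
have dom v y : v \in reach G Y -> y \in Y -> adj G v y -> v != ord0 ->
    forall x, x \in Y -> x \notin reach G [set v].
  move=> Rv Yy vy v0; apply: outer_dominates vy _ => //; first exact: reach_notin Rv.
  by apply: (subsetP (reach_inner _)) Rv; rewrite sub1set.
have sep v v' x x' : v \in reach G Y -> v' \in reach G Y -> x \in Y -> x' \in Y ->
    adj G v x -> adj G v' x' -> v != ord0 -> v' \notin reach G [set v].
  move=> Rv Rv' Yx Yx' vx v'x' v0; apply: contra (dom v x Rv Yx vx v0 x' Yx') => R'.
  apply: reach1_step R' v'x' _ => //.
  by apply: contraTneq Yx' => ->; apply: reach_notin Rv.
move=> Rz Rz' Yw Yw' zw z'w'; apply/eqP; apply: contraT => zz'.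
have [z0|z0] := eqVneq z ord0.
  have z'0 : z' != ord0 by rewrite -z0 eq_sym.
  by have := sep z' z w' w Rz' Rz Yw' Yw z'w' zw z'0; rewrite z0 reach0.
have [z'0|z'0] := eqVneq z' ord0.
  by have := sep z z' w w' Rz Rz' Yw Yw' zw z'w' z0; rewrite z'0 reach0.
have := dominates_asym G z0 z'0 zz'.
have sz := sep z z' w w' Rz Rz' Yw Yw' zw z'w' z0.
by rewrite (negPf sz) (negPf (sep z' z w' w Rz' Rz Yw' Yw z'w' zw z'0)).
Qed.

Lemma gate_exists : exists i w, [/\ i \in reach G Y, w \in Y & adj G i w].
Proof.
have [y Yy] : exists y, y \in Y by apply/set0Pn; rewrite -card_gt0 ltnW.
have [/existsP[i /existsP[w /and3P[? ? ?]]]|/existsPn none] :=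
  boolP [exists i, exists w, [&& i \in reach G Y, w \in Y & adj G i w]].
  by exists i, w.
suff all_reach x : x \in reach G Y.
  by have := reach_notin Y0 (all_reach y); rewrite Yy.
move: x; apply: (reach_closedT (G := G) (reach0 G Y)) => u v Ru uv.
apply: (reach_step Y0 Ru uv); apply/negP => Yv.
by have /existsPn/(_ v) := none u; rewrite Ru Yv uv.
Qed.

Lemma inner_reach u w : u \in Y -> w \in Y -> u != w -> w \in reach G [set u].
Proof.
move=> Yu Yw uw; apply: contraLR (inner Yu Yw uw).
by apply: not_entangled_dom; apply: inner_neq0.
Qed.

Lemma sub_pair u w : u \in Y -> w \in Y -> [set u; w] \subset Y.
Proof. by move=> Yu Yw; rewrite subUset !sub1set Yu. Qed.

(** A neighbour of u outside [Y] that counts in the mass of u is reached even without [Y], so the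
    neighbour lost by deleting w must lie in [Y]. *)
Lemma inner_witness u w : u \in Y -> w \in Y -> u != w ->
  exists z, [/\ z \in Y, adj G u z & z \notin reach G [set u; w]].
Proof.
move=> Yu Yw uw; have [u0 w0] := (inner_neq0 Yu, inner_neq0 Yw).
have /andP[/(ltn_pmassP G u0 w0)[z [uz Rz Rz']] _] := inner Yu Yw uw.
exists z; split=> //; apply: contraR Rz' => Yz.
apply: (subsetP (reach_inner (sub_pair Yu Yw))).
by apply: outer_reach Rz; rewrite // adjC.
Qed.

Lemma pair_reach_grow u w z : u \in Y -> w \in Y -> z \in Y -> u != w -> z != w ->
  z \notin reach G [set u; w] ->
  w \in reach G [set u; z] /\ reach G [set u; w] \proper reach G [set u; z].
Proof.
move=> Yu Yw Yz uw zw; have Rw := inner_reach Yu Yw uw.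
by apply: reach2_grow => //; apply: inner_neq0.
Qed.

Lemma cut_sum u w : u \in Y -> w \in Y -> u != w ->
  \sum_(z in reach G [set u] :\: reach G [set u; w]) wt G u z = eps.
Proof.
move=> Yu Yw uw; have [u0 w0] := (inner_neq0 Yu, inner_neq0 Yw).
have := mass_inner Yu Yw uw; rewrite /mass /pmass /wdeg (big_setID (reach G [set u; w])) /=.
by rewrite (setIidPr (reach2_l G u0 w0)) => /addnI.
Qed.

(** Induction on what {u, w} cuts off: the lost neighbour z of u is either w, or {z, w} cuts off
    strictly less. *)
Lemma inner_connected : connected_on (adj G) Y.
Proof.
suff conn k u w : #|~: reach G [set u; w]| <= k -> u \in Y -> w \in Y ->
    connect (induced (adj G) Y) u w.
  by move=> u w Yu Yw; apply: conn Yu Yw.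
elim: k u w => [|k IHk] u w le_k Yu Yw.
  move: le_k; rewrite leqn0 cards_eq0 => /eqP/setP/(_ u).
  by rewrite in_setC in_set0 (reach2_self G (inner_neq0 Yu) (inner_neq0 Yw)).1.
have [->//|uw] := eqVneq u w.
have [z [Yz uz Rz]] := inner_witness Yu Yw uw.
have [<-|zw] := eqVneq z w; first by apply: connect1; rewrite inducedE Yu Yz.
have conn_uz : connect (induced (adj G) Y) u z by apply: connect1; rewrite inducedE Yu Yz.
apply: connect_trans conn_uz (IHk _ _ _ Yz Yw); rewrite -ltnS; apply: leq_trans le_k.
apply: proper_card; rewrite properC; rewrite setUC in Rz *.
have wu : w != u by rewrite eq_sym.
have zu : z != u by rewrite eq_sym (adj_neq uz).
by rewrite [X in _ \proper reach _ X]setUC; case: (pair_reach_grow Yw Yu Yz wu zu Rz).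
Qed.

(* The edges from u to vertices cut off from the root by {u, w} have total weight eps. A
   second such neighbour z of u gives a pair {u, z} cutting off less, so it already has
   weight eps by induction. *)
Lemma inner_wt u w : u \in Y -> w \in Y -> adj G u w -> wt G u w = eps.
Proof.
suff wtE k v x : #|~: reach G [set v; x]| <= k -> v \in Y -> x \in Y -> adj G v x ->
  wt G v x = eps by move=> *; apply: wtE.
elim: k v x {u w} => [|k IHk] v x le_k Yv Yx vx.
  move: le_k; rewrite leqn0 cards_eq0 => /eqP/setP/(_ v).
  by rewrite in_setC in_set0 (reach2_self G (inner_neq0 Yv) (inner_neq0 Yx)).1.
have [v0 x0 nvx] := And3 (inner_neq0 Yv) (inner_neq0 Yx) (adj_neq vx).
have Dx : x \in reach G [set v] :\: reach G [set v; x].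
  by rewrite in_setD inner_reach // (reach2_self G v0 x0).2.
have := cut_sum Yv Yx nvx; rewrite (bigD1 x) //=.
set rest := (X in _ + X = _); have [->|] := posnP rest; first by rewrite addn0.
rewrite lt0n {}/rest sum_nat_eq0 => /forallPn[z].
rewrite negb_imply -lt0n => /andP[/andP[Dz zx] vz].
move: (Dz); rewrite in_setD => /andP[Rz' Rz].
have Yz : z \in Y.
  apply: contraR Rz' => Yz; apply: (subsetP (reach_inner (sub_pair Yv Yx))).
  by apply: outer_reach Rz; rewrite // adjC.
have wt_z : wt G v z = eps.
  apply: IHk => //; rewrite -ltnS; apply: leq_trans le_k; apply: proper_card.
  by rewrite properC; case: (pair_reach_grow Yv Yx Yz nvx zx Rz').
rewrite (bigD1 z) /=; last by rewrite Dz.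
rewrite wt_z addnCA => /eqP; rewrite -[X in _ == X]addn0 eqn_add2l addn_eq0 => /andP[/eqP wt0 _].
by move: vx; rewrite /adj /= wt0.
Qed.

(** The lost edges at u have total weight [eps], and each of them alone already has weight [eps]. *)
Lemma inner_cut u w : u \in Y -> w \in Y -> u != w ->
  exists z, [/\ z \in Y, adj G u z & z \notin reach G [set u; w]] /\
    forall z', adj G u z' -> z' \in Y -> z' \notin reach G [set u; w] -> z' = z.
Proof.
move=> Yu Yw uw; have [z [Yz uz Rz]] := inner_witness Yu Yw uw.
exists z; split=> // z' uz' Yz' Rz'; apply/eqP; apply: contraT => z'z.
have [u0 w0] := (inner_neq0 Yu, inner_neq0 Yw).
have inD v : v \in Y -> adj G u v -> v \notin reach G [set u; w] ->
    v \in reach G [set u] :\: reach G [set u; w].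
  by move=> Yv uv Rv; rewrite in_setD Rv inner_reach // (adj_neq uv).
have := cut_sum Yu Yw uw; rewrite (bigD1 z) ?inD //= (bigD1 z') /=; last by rewrite inD.
rewrite (inner_wt Yu Yz uz) (inner_wt Yu Yz' uz') => /eqP.
rewrite -[X in _ == X]addn0 eqn_add2l addn_eq0 => /andP[/eqP eps0 _].
by move: (uz); rewrite /adj /= (inner_wt Yu Yz uz) eps0.
Qed.

Variables (i w0 : V).
Hypotheses (Ri : i \in reach G Y) (Yw0 : w0 \in Y) (iw0 : adj G i w0).

Lemma gate_notin : i \notin Y. Proof. exact: reach_notin Ri. Qed.

(** A neighbour of u outside [Y] that counts in its mass is a gate, hence i; and no vertex of [Y]
    cuts off i or another vertex of [Y]. *)
Lemma mass_inner_sum u : u \in Y -> mass G u = wt G u i + \sum_(z in Y) wt G u z.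
Proof.
move=> Yu; have Rui : i \in reach G [set u].
  by apply: (subsetP (reach_inner _)) Ri; rewrite sub1set.
have -> : wt G u i + \sum_(z in Y) wt G u z = \sum_(z in i |: Y) wt G u z.
  by rewrite [RHS](big_setD1 i) ?setU11 //= setU1K ?gate_notin.
rewrite /mass /wdeg [LHS](big_setID (i |: Y)) [RHS](big_setID (reach G [set u])) /= setIC.
congr (_ + _); rewrite !big1 // => z; rewrite in_setD => /andP[].
  move=> Rz /setU1P[def_z|Yz]; first by rewrite def_z Rui in Rz.
  have [<-|uz] := eqVneq u z; first exact: wt_loopless.
  by rewrite inner_reach in Rz.
rewrite in_setU1 negb_or => /andP[zi Yz] Rz; apply/eqP; apply: contraR zi.
rewrite -lt0n => uz; have zu : adj G z u by rewrite adjC.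
by rewrite (gate_unique (outer_reach Yz Yu zu Rz) Ri Yu Yw0 zu iw0).
Qed.

Definition inner_deg u := #|[set z in Y | adj G u z]|.

Lemma mass_inner_deg u : u \in Y -> mass G u = wt G u i + inner_deg u * eps.
Proof.
move=> Yu; rewrite mass_inner_sum // /inner_deg (bigID (adj G u)) /= [X in _ + (_ + X)]big1.
  rewrite addn0 -sum_nat_const; congr (_ + _).
  rewrite (eq_bigr (fun=> eps)); first by apply: eq_bigl => z; rewrite inE.
  by move=> z /andP[Yz uz]; apply: inner_wt.
by move=> z /andP[_]; rewrite /adj /= -eqn0Ngt => /eqP.
Qed.

Lemma eps_gt0 : 0 < eps.
Proof.
have [u Yu] : exists u, u \in Y :\ w0.
  by apply/set0Pn; rewrite -card_gt0 -(ltn_add2l (w0 \in Y)) -cardsD1 Yw0.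
have [uw0 Yu'] := setD1P Yu; have [z [Yz uz _]] := inner_witness Yu' Yw0 uw0.
by rewrite -(inner_wt Yu' Yz uz).
Qed.

Lemma inner_deg_gt0 u : u \in Y -> 0 < inner_deg u.
Proof.
move=> Yu; have [w Yw] : exists w, w \in Y :\ u.
  by apply/set0Pn; rewrite -card_gt0 -(ltn_add2l (u \in Y)) -cardsD1 Yu.
have [wu Yw'] := setD1P Yw; rewrite eq_sym in wu.
have [z [Yz uz _]] := inner_witness Yu Yw' wu.
by rewrite card_gt0; apply/set0Pn; exists z; rewrite inE Yz.
Qed.

(** Mass [2 * eps] leaves two possibilities for a vertex of [Y]: two neighbours in [Y] and no edge
    to i, or one neighbour in [Y] and an edge of weight [eps] to i. Either way it has degree 2. *)
Lemma mass2_cycle : {in Y, forall u, mass G u = 2 * eps} -> weighted_cycle G eps (i |: Y).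
Proof.
move=> mass2; have eps0 := eps_gt0; have Yi := gate_notin.
have deg2 y : y \in Y -> (adj G y i -> wt G y i = eps) /\ #|[set z in i |: Y | adj G y z]| = 2.
  move=> Yy; have -> : #|[set z in i |: Y | adj G y z]| = adj G y i + inner_deg y.
    rewrite (cardsD1 i) inE setU11 /=; congr (_ + _); apply: eq_card => z.
    by rewrite !inE; have [->|] //= := eqVneq z i; rewrite (negPf Yi).
  have := mass2 y Yy; rewrite mass_inner_deg //; have := inner_deg_gt0 Yy.
  rewrite /adj /=; case: (inner_deg y) => [|[|[|d]]] // _.
  - by rewrite mul1n mul2n -addnn => /eqP; rewrite eqn_add2r => /eqP->; rewrite eps0.
  - by rewrite -{2}[2 * eps]add0n => /eqP; rewrite eqn_add2r => /eqP->.
  move=> E; suff: 2 * eps < 2 * eps by rewrite ltnn.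
  by rewrite -{2}E ltn_addl // ltn_pmul2r.
case: (@cycle_of_degree2 _ (adj G) i Y) => [||||||c [uniq_c sz_c mem_c c_adj]].
- exact: adjC.
- exact: adjxx.
- by [].
- by move=> y Yy; case: (deg2 y Yy).
- exact: inner_connected.
- by exists w0.
exists c; split=> // x y Sx Sy; rewrite -c_adj //.
case: ifP => [xy|]; last by rewrite /adj /= lt0n => /eqP.
case/setU1P: Sx xy => [->|Yx]; case/setU1P: Sy => [->|Yy] xy.
- by rewrite adjxx in xy.
- by rewrite wt_sym; case: (deg2 y Yy) => -> //; rewrite adjC.
- by case: (deg2 x Yx) => ->.
exact: inner_wt.
Qed.

Lemma inner_shape : exists b c, [/\ 0 < b, 0 < c
  & weighted_cycle G b (i |: Y) \/ weighted_complete G i b c Y].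
Proof.
have [/forall_inP complete|] := boolP [forall u in Y, forall w in Y, (u != w) ==> adj G u w].
  have adjE u w : u \in Y -> w \in Y -> u != w -> adj G u w.
    by move=> Yu Yw uw; have /forall_inP/(_ w Yw)/implyP := complete u Yu; apply.
  exists (wt G w0 i), eps; split; [by rewrite wt_sym | exact: eps_gt0 | right].
  (* All inner degrees agree, so equal masses force equal weights on the edges to the gate. *)
  have degE u : u \in Y -> inner_deg u = #|Y|.-1.
    move=> Yu; rewrite (cardsD1 u Y) Yu /=; apply: eq_card => z; rewrite !inE andbC.
    have [->|zu] := eqVneq z u; first by rewrite adjxx.
    by case: (boolP (z \in Y)) => [Yz|]; rewrite ?andbF // adjE // eq_sym.
  have wt_i u : u \in Y -> wt G u i = wt G w0 i.
    move=> Yu; have := mass_cst Yu Yw0.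
    by rewrite !mass_inner_deg // !degE // => /eqP; rewrite eqn_add2r => /eqP.
  move=> x y Sx Sy xy; have [xi|xi] := eqVneq x i.
    case/setU1P: Sy => [yi|Yy]; first by rewrite xi yi eqxx in xy.
    by rewrite xi wt_sym wt_i.
  have {Sx}Yx : x \in Y by case/setU1P: Sx => // /eqP; rewrite (negPf xi).
  have [->|yi] /= := eqVneq y i; first exact: wt_i.
  have {Sy}Yy : y \in Y by case/setU1P: Sy => // /eqP; rewrite (negPf yi).
  by apply: inner_wt; rewrite ?adjE.
(* a non-adjacent pair {u, w} cutting off as little as possible cuts off a single vertex of
   Y, all of whose edges go to u and w *)
case/forall_inPn => u1 Yu1 /forall_inPn[w1 Yw1]; rewrite negb_imply => /andP[uw1 nadj1].
pose P (t : V * V) := [&& t.1 \in Y, t.2 \in Y, t.1 != t.2 & ~~ adj G t.1 t.2].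
have P1 : P (u1, w1) by rewrite /P Yu1 Yw1 uw1.
case: (arg_maxnP (fun t : V * V => #|reach G [set t.1; t.2]|) P1).
move=> -[u w] /= /and4P[Yu Yw uw nuw] max_uw.
have max_adj x y : x \in Y -> y \in Y -> x != y ->
    reach G [set u; w] \proper reach G [set x; y] -> adj G x y.
  move=> Yx Yy xy /proper_card; apply: contraLR => nxy; rewrite -leqNgt.
  by apply: (max_uw (x, y)); rewrite /P /= Yx Yy xy.
have wu : w != u by rewrite eq_sym.
have [z [[Yz uz Rz] uniq_z]] := inner_cut Yu Yw uw.
have zw : z != w by apply: contraNneq nuw => <-.
have zu : z != u by rewrite eq_sym (adj_neq uz).
have [_ growu] := pair_reach_grow Yu Yw Yz uw zw Rz.
have growz : reach G [set u; w] \proper reach G [set w; z].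
  rewrite setUC in Rz *; by case: (pair_reach_grow Yw Yu Yz wu zu Rz).
have wz : adj G w z by apply: max_adj; rewrite // eq_sym.
(* A further neighbour v of z would be cut off together with z; by extremality it would be adjacent
   to u, and the uniqueness of the lost neighbour of u would give v = z. *)
have only v : v \in Y -> adj G z v -> v = u \/ v = w.
  move=> Yv zv; have [vu|vu] := eqVneq v u; [by left | right].
  apply/eqP; apply: contraT => vw.
  have Rv : v \notin reach G [set u; w].
    apply: contra Rz => Rv; apply: (reach2_step (inner_neq0 Yu) (inner_neq0 Yw) Rv) => //.
    by rewrite adjC.
  have [_ growv] := pair_reach_grow Yu Yw Yv uw vw Rv.
  have uv : adj G u v by apply: max_adj; rewrite // eq_sym.
  by move: zv; rewrite (uniq_z v uv Yv Rv) adjxx.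
exists eps, 1; split=> //; first exact: eps_gt0.
left; apply: mass2_cycle => y Yy; rewrite (mass_cst Yy Yz) mass_inner_deg //.
have -> : wt G z i = 0.
  apply/eqP; rewrite -leqn0 leqNgt; apply: contra Rz => zi.
  apply: (reach2_step (inner_neq0 Yu) (inner_neq0 Yw) (x := i)) => //; last by rewrite adjC.
  by apply: (subsetP (reach_inner (sub_pair Yu Yw))).
rewrite add0n; congr (_ * _).
have -> : inner_deg z = #|[set u; w]|; last by rewrite cards2 uw.
apply: eq_card => v; rewrite in_set2 inE; apply/andP/orP => [[Yv zv]|].
  by case: (only v Yv zv) => ->; rewrite eqxx; [left | right].
by case=> /eqP->; rewrite adjC.
Qed.

End EntangledNode.

(** * Nodes of the component graph *)

Lemma induced_connect_sym (T : finType) (e : rel T) (S : {set T}) :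
  symmetric e -> connect_sym (induced e S).
Proof. by move=> symE; apply: sym_connect_sym => x y; rewrite !inducedE symE andbCA. Qed.

Lemma vparking_ext n (G : rooted_graph n) f f' : f =1 f' -> vparking G f -> vparking G f'.
Proof. by move=> ff' park U U0 Un0; have [i Ui] := park U U0 Un0; rewrite ff'; exists i. Qed.

Section Nodes.
Variables (p q : nat) (G : rooted_graph (p + q)).
Local Notation V := 'I_(p + q).+1.
Local Notation A := (Aset p q).
Local Notation B := (Bset p q).
Implicit Types (S X Y : {set V}) (u v w x y z : V).

Definition is_side S := S = A \/ S = B.

Lemma side0 S : is_side S -> ord0 \notin S.
Proof. by case=> ->; rewrite ?Aset0 ?Bset0. Qed.

Lemma same_component_equiv S : {in S & &, equivalence_rel (same_component G S)}.
Proof.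
have symG := induced_connect_sym (ord0 |: S) (@adjC _ G).
move=> x y z Sx Sy Sz; rewrite /same_component /= Sx Sy Sz; split; first exact: connect0.
by move=> xy; apply/idP/idP; apply: connect_trans; rewrite // symG.
Qed.

Lemma node_equivE S x y : is_side S -> x \in S -> node_equiv G x y = same_component G S x y.
Proof.
move=> sideS Sx; have x0 : x != ord0 by apply: contraTneq Sx => ->; apply: side0.
rewrite /node_equiv /same_component /= (negPf x0) /=.
have xB := in_AB x0; case: sideS Sx => -> Sx; rewrite Sx in xB *.
  by rewrite xB orbF.
by move/esym/negPf: xB => ->.
Qed.

Lemma node_equiv0 y : node_equiv G ord0 y = (y == ord0).
Proof. by rewrite /node_equiv /same_component /= (negPf (Aset0 p q)) (negPf (Bset0 p q)) !orbF. Qed.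

Lemma side_of x : x != ord0 -> exists2 S, is_side S & x \in S.
Proof.
move=> x0; have := in_AB x0; have [xA _|_ xB] := boolP (x \in A).
  by exists A; first left.
by exists B; first right.
Qed.

Lemma node_equiv_equivalence : {in [set: V] & &, equivalence_rel (node_equiv G)}.
Proof.
move=> x y z _ _ _; split.
  have [->|z0] := eqVneq z ord0; first exact: (etrans (node_equiv0 _) (eqxx _)).
  have [S sideS Sz] := side_of z0; rewrite (node_equivE _ sideS Sz).
  by have [refl _] := same_component_equiv Sz Sz Sz.
have [->|x0] := eqVneq x ord0; first by rewrite node_equiv0 => /eqP->.
have [S sideS Sx] := side_of x0; rewrite !(node_equivE _ sideS Sx) => xy.
have /and3P[_ Sy _] := xy; rewrite (node_equivE _ sideS Sy).
have [Sz|Sz] := boolP (z \in S); last by rewrite /same_component /= (negPf Sz) !andbF.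
by have [_ ->] := same_component_equiv Sx Sy Sz.
Qed.

Definition node_of x := pblock (nodes G) x.

Lemma nodes_partition : partition (nodes G) [set: V].
Proof. exact/equivalence_partitionP/node_equiv_equivalence. Qed.

Lemma node_of_nodes x : node_of x \in nodes G.
Proof. by apply: pblock_mem; case/and3P: nodes_partition => /eqP->; rewrite in_setT. Qed.

Lemma mem_node_of x y : (y \in node_of x) = node_equiv G x y.
Proof. by apply: (pblock_equivalence_partition node_equiv_equivalence); rewrite in_setT. Qed.

Lemma node_of_refl x : x \in node_of x.
Proof. by rewrite mem_pblock; case/and3P: nodes_partition => /eqP->; rewrite in_setT. Qed.

Lemma node_of_eq x y : x \in node_of y -> node_of x = node_of y.
Proof.
move=> xy; have /and3P[_ triv _] := nodes_partition.
by rewrite [node_of x](def_pblock triv (node_of_nodes y) xy).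
Qed.

Lemma nodesP N : N \in nodes G -> exists2 x, x \in N & N = node_of x.
Proof.
move=> NG; have /and3P[_ triv N0] := nodes_partition.
have /set0Pn[x Nx] : N != set0 by apply: contraNneq N0 => <-.
by exists x; rewrite // /node_of (def_pblock triv NG Nx).
Qed.

Lemma in_node_of S x y : is_side S -> x \in S ->
  (y \in node_of x) = (y \in S) && connect (induced (adj G) (ord0 |: S)) x y.
Proof. by move=> sideS Sx; rewrite mem_node_of (node_equivE _ sideS Sx) /same_component /= Sx. Qed.

Lemma node_of_sub S x : is_side S -> x \in S -> node_of x \subset S.
Proof. by move=> sideS Sx; apply/subsetP => y; rewrite (in_node_of _ sideS Sx) => /andP[]. Qed.

Lemma node_of0 : node_of ord0 = [set ord0].
Proof. by apply/setP => y; rewrite mem_node_of node_equiv0 in_set1. Qed.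

Lemma adj_node_of S x y : is_side S -> x \in S -> y \in S -> adj G x y -> y \in node_of x.
Proof.
move=> sideS Sx Sy xy; rewrite (in_node_of _ sideS Sx) Sy; apply: connect1.
by rewrite inducedE !in_setU1 Sx Sy xy !orbT.
Qed.

(* Otherwise the nodes of y1 and y2 would lie with that of Z on a cycle of the component graph. *)
Lemma node_of_unique Z z1 z2 y1 y2 : component_graph_is_tree G ->
  z1 \in node_of Z -> z2 \in node_of Z -> adj G z1 y1 -> adj G z2 y2 ->
  y1 \notin node_of Z -> y2 \notin node_of Z ->
  connect (induced (adj G) (~: node_of Z)) y1 y2 -> node_of y1 = node_of y2.
Proof.
case=> _ _ acyc Zz1 Zz2 zy1 zy2 Zy1 Zy2 conn; apply/eqP; apply: contraT => neq_y.
pose E := induced (node_adj G) (nodes G :\ node_of Z).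
have in_rest y : y \notin node_of Z -> node_of y \in nodes G :\ node_of Z.
  move=> Zy; rewrite in_setD1 node_of_nodes andbT.
  by apply: contraNneq Zy => <-; apply: node_of_refl.
have: connect E (node_of y1) (node_of y2).
  pose K := [pred v | connect E (node_of y1) (node_of v)].
  suff: y2 \in K by [].
  apply: (connect_stable (K := K) _ conn); last exact: connect0.
  move=> u v Ku; rewrite inducedE !in_setC => /and3P[Zu Zv uv].
  have [E_uv|uv'] := eqVneq (node_of u) (node_of v); first by move: Ku; rewrite !inE E_uv.
  apply: connect_trans (connect1 _); first exact: Ku.
  rewrite /E inducedE !in_rest // /node_adj /= uv'; apply/exists_inP.
  by exists u; rewrite ?node_of_refl //; apply/exists_inP; exists v; rewrite ?node_of_refl.
case/connectP=> s0 /shortenP[s path_s uniq_s _] last_s {s0}.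
have adj_Z z y : z \in node_of Z -> adj G z y -> y \notin node_of Z ->
    node_adj G (node_of Z) (node_of y).
  move=> Zz zy Zy; rewrite /node_adj /=; apply/andP; split.
    by apply: contraNneq Zy => ->; apply: node_of_refl.
  by apply/exists_inP; exists z => //; apply/exists_inP; exists y; rewrite ?node_of_refl.
have subE : subrel E (induced (node_adj G) (nodes G)).
  move=> N M; rewrite /E !inducedE => /and3P[/setD1P[_ NG] /setD1P[_ MG] NM].
  by rewrite NG MG.
have s_rest N : N \in s -> N \in nodes G :\ node_of Z.
  move: path_s {last_s uniq_s}; elim: s (node_of y1) => //= M s IHs N0 /andP[E_NM path_s].
  rewrite inE => /predU1P[->|]; last exact: IHs path_s.
  by case/and3P: E_NM.
have symN : symmetric (node_adj G).
  move=> N M; rewrite /node_adj /= eq_sym; congr (_ && _); apply/exists_inP/exists_inP.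
    move=> [u Nu /exists_inP[v Mv uv]]; exists v => //.
    by apply/exists_inP; exists u; rewrite // adjC.
  move=> [u Nu /exists_inP[v Mv uv]]; exists v => //.
  by apply/exists_inP; exists u; rewrite // adjC.
have: size [:: node_of Z, node_of y1 & s] < 3.
  apply: acyc; apply/andP; split; last first.
    rewrite cons_uniq uniq_s andbT inE negb_or eq_sym; apply/andP; split.
      by have /setD1P[] := in_rest y1 Zy1.
    by apply/negP => /s_rest/setD1P[]; rewrite eqxx.
  rewrite /= rcons_path (sub_path subE path_s) -last_s /= !inducedE !node_of_nodes.
  by rewrite (adj_Z z1 y1) // symN (adj_Z z2 y2).
case: s {path_s uniq_s s_rest} last_s => //= last_s.
by rewrite last_s eqxx in neq_y.
Qed.

End Nodes.

(** * Entangled pairs across the two sides *)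

Section CrossEntangled.
Variables (p q : nat) (G : rooted_graph (p + q)).
Local Notation V := 'I_(p + q).+1.
Local Notation node_of := (node_of G).
Variables X Y : {set V}.
Implicit Types (S : {set V}) (u v w x y z : V).

Hypotheses (sideX : is_side X) (sideY : is_side Y).
Hypothesis XY : forall v, v != ord0 -> (v \in Y) = (v \notin X).
Hypotheses (X_neq0 : X != set0) (Y_neq0 : Y != set0).
Hypothesis cross : forall x y, x \in X -> y \in Y -> entangled G x y.

Let X0 := side0 sideX.
Let Y0 := side0 sideY.

Lemma X_notin_Y x : x \in X -> x \notin Y.
Proof. by move=> Xx; rewrite XY ?Xx //; apply: contraNneq X0 => <-. Qed.

Lemma sideX_neq0 x : x \in X -> x != ord0.
Proof. by move=> Xx; apply: contraNneq X0 => <-. Qed.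

Lemma sideY_neq0 x : x \in Y -> x != ord0.
Proof. by move=> Yx; apply: contraNneq Y0 => <-. Qed.

(** Across the two sides, entanglement excludes domination. If u dominated w on its own side,
    [entangled_dom] would make u dominate a vertex of the other side, which is entangled with
    both. *)
Lemma cross_reach u w : u != ord0 -> w != ord0 -> u != w -> w \in reach G [set u].
Proof.
move=> u0 w0 uw.
have reach_ent x y : x != ord0 -> y != ord0 -> entangled G x y -> y \in reach G [set x].
  by move=> x0 y0; apply: contraLR; apply: not_entangled_dom.
have same x : x != ord0 -> entangled G w x -> x \in reach G [set u] -> u != x ->
    w \in reach G [set u].
  move=> x0 ent Rx ux; apply: contraLR Rx => Rw.
  exact: (entangled_dom u0 w0 x0 uw ux ent Rw).
have [Xu|Xu] := boolP (u \in X); have [Xw|Xw] := boolP (w \in X).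
- have /set0Pn[y Yy] := Y_neq0; have y0 := sideY_neq0 Yy.
  apply: (same y y0 (cross Xw Yy)); first exact: reach_ent (cross Xu Yy).
  by apply: contraTneq Yy => <-; apply: X_notin_Y.
- by apply: reach_ent => //; apply: cross; rewrite ?XY.
- by apply: reach_ent => //; rewrite entangledC; apply: cross; rewrite ?XY.
have /set0Pn[x Xx] := X_neq0; have x0 := sideX_neq0 Xx.
apply: (same x x0).
- by rewrite entangledC; apply: cross; rewrite ?XY.
- by apply: reach_ent => //; rewrite entangledC; apply: cross; rewrite ?XY.
by apply: contraTneq Xx => <-.
Qed.

Lemma cross_connect u w : u != ord0 -> w != ord0 ->
  connect (induced (adj G) (~: [set ord0])) u w.
Proof.
have symG := induced_connect_sym (~: [set ord0]) (@adjC _ G).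
have conn x y : x \in X -> y \in Y -> connect (induced (adj G) (~: [set ord0])) x y.
  by move=> Xx Yy; apply: entangled_connect (sideX_neq0 Xx) (sideY_neq0 Yy) (cross Xx Yy).
have /set0Pn[x Xx] := X_neq0; have /set0Pn[y Yy] := Y_neq0.
have to_x v : v != ord0 -> connect (induced (adj G) (~: [set ord0])) x v.
  move=> v0; have [Xv|Xv] := boolP (v \in X); last by apply: conn; rewrite ?XY.
  by apply: connect_trans (conn x y Xx Yy) _; rewrite symG conn.
by move=> u0 w0; apply: connect_trans (to_x w w0); rewrite symG to_x.
Qed.

Hypothesis tree : component_graph_is_tree G.

(** The graph stays connected without its root, so two nodes adjacent to the root would create a
    cycle of nodes. *)
Lemma root_neighbours y1 y2 : adj G ord0 y1 -> adj G ord0 y2 -> node_of y1 = node_of y2.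
Proof.
move=> y01 y02; have neq0 y : adj G ord0 y -> y != ord0 by rewrite eq_sym => /adj_neq.
apply: (node_of_unique tree (Z := ord0) (z1 := ord0) (z2 := ord0)) => //;
  rewrite ?node_of_refl ?node_of0 ?in_set1 ?neq0 //.
by apply: cross_connect; apply: neq0.
Qed.

Hypothesis invX : swap_invariant G X.
Hypothesis disconnected : ~ connected_on (adj G) (ord0 |: X).
Variable r : V.
Hypotheses (Xr : r \in X) (adj0r : adj G ord0 r).

Local Notation N := (node_of r).

Lemma setCY : ~: Y = ord0 |: X.
Proof.
apply/setP => v; rewrite in_setC in_setU1; have [->|v0] := eqVneq v ord0; first by rewrite Y0.
by rewrite XY // negbK.
Qed.

Lemma root_node y : adj G ord0 y -> y \in N.
Proof. by move=> y0; rewrite (root_neighbours adj0r y0) node_of_refl. Qed.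

Lemma NX : {subset N <= X}.
Proof. exact/subsetP/node_of_sub. Qed.

Lemma reach_Y x : (x \in N) = (x \in X) && (x \in reach G Y).
Proof.
rewrite (in_node_of _ _ sideX Xr) in_reach setCY; case: (boolP (x \in X)) => //= Xx.
have symG := induced_connect_sym (ord0 |: X) (@adjC _ G).
have conn0r : connect (induced (adj G) (ord0 |: X)) ord0 r.
  by apply: connect1; rewrite inducedE setU11 setU1r.
by apply/idP/idP; apply: connect_trans; rewrite // symG.
Qed.

Lemma N_neq0 x : x \in N -> x != ord0.
Proof. by move/NX/sideX_neq0. Qed.

Lemma Y_not_root y : y \in Y -> adj G ord0 y = false.
Proof. by move=> Yy; apply/negP => /root_node/NX/X_notin_Y; rewrite Yy. Qed.

Lemma N_out m z : m \in N -> adj G m z -> z != ord0 -> z \notin N -> z \in Y.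
Proof.
move=> Nm mz z0; apply: contraR; rewrite XY // negbK => Xz.
move: Nm; rewrite !reach_Y Xz => /andP[_ Rm] /=.
by apply: reach_step Y0 Rm mz _; apply: X_notin_Y.
Qed.

Lemma far_vertex : exists2 x, x \in X & x \notin N.
Proof.
apply/exists_inP; apply: contraT => /exists_inPn allN; case: disconnected.
have conn0 x : x \in ord0 |: X -> connect (induced (adj G) (ord0 |: X)) ord0 x.
  case/setU1P=> [->|Xx]; first exact: connect0.
  by have := allN x Xx; rewrite negbK reach_Y Xx /= in_reach setCY.
move=> x y Sx Sy; apply: connect_trans (conn0 y Sy).
by rewrite induced_connect_sym ?conn0 //; apply: adjC.
Qed.

(** The root has no neighbour in [Y], so the paths that define a [Y]-node never pass through it. *)
Lemma nodeY_connect y y' : y \in Y -> y' \in node_of y ->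
  connect (induced (adj G) (node_of y)) y y'.
Proof.
move=> Yy; rewrite (in_node_of _ _ sideY Yy) => /andP[_ conn].
pose K := [pred v | (v \in node_of y) && connect (induced (adj G) (node_of y)) y v].
suff /andP[] : y' \in K by [].
apply: (connect_stable (K := K) _ conn); last by rewrite inE node_of_refl connect0.
move=> u v /andP[yu conn_u]; rewrite inducedE => /and3P[_ Sv uv].
have Yu := subsetP (node_of_sub G sideY Yy) u yu.
have yv : v \in node_of y.
  case/setU1P: Sv => [v0|Yv]; first by rewrite v0 adjC Y_not_root in uv.
  by rewrite -(node_of_eq yu) (adj_node_of sideY).
by rewrite inE yv /=; apply: connect_trans conn_u (connect1 _); rewrite inducedE yu yv.
Qed.

Lemma nodeY_reach S y y' : ord0 \notin S -> y \in Y -> y' \in node_of y ->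
  [disjoint node_of y & S] -> y \in reach G S -> y' \in reach G S.
Proof.
move=> S0 Yy yy' dis Ry; apply: (connect_stable _ (nodeY_connect Yy yy') Ry) => u v Ru.
rewrite inducedE => /and3P[_ yv uv]; apply: reach_step S0 Ru uv _.
by rewrite (disjointFr dis).
Qed.

(** The non-root vertices whose node is at distance at least 2 from [N] in the component graph. *)
Definition far : {set V} :=
  [set u | (u != ord0) && (u \notin N) & [forall z in node_of u, forall m in N, ~~ adj G m z]].

Lemma farP u : u \in far -> [/\ u != ord0, u \notin N
  & forall z m, z \in node_of u -> m \in N -> ~~ adj G m z].
Proof.
rewrite inE => /andP[/andP[u0 Nu] /forall_inP all_u]; split=> // z m uz Nm.
by have /forall_inP/(_ m Nm) := all_u z uz.
Qed.

Lemma not_farP z : z != ord0 -> z \notin N -> z \notin far ->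
  exists x m, [/\ x \in node_of z, m \in N & adj G m x].
Proof.
move=> z0 Nz; rewrite inE z0 Nz /= => /forall_inPn[x zx /forall_inPn[m Nm]].
by rewrite negbK => mx; exists x, m.
Qed.

Lemma far_X x : x \in X -> x \notin N -> x \in far.
Proof.
move=> Xx Nx; rewrite inE sideX_neq0 // Nx; apply/forall_inP => z xz; apply/forall_inP => m Nm.
have Xz := subsetP (node_of_sub G sideX Xx) z xz.
apply: contra Nx => mz; have Nz : z \in N.
  by apply: contraLR (X_notin_Y Xz) => Nz; rewrite negbK; apply: N_out mz _ Nz; rewrite ?sideX_neq0.
by rewrite -(node_of_eq Nz) (node_of_eq xz) node_of_refl.
Qed.

(* Choose u away from the node N and w in N such that {u, w} cuts off as little as possible. *)
Lemma far_pair : exists u w, [/\ u \in far, w \in N & ~~ entangled G u w].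
Proof.
have [x0 Xx0 Nx0] := far_vertex.
pose P (t : V * V) := (t.1 \in far) && (t.2 \in N).
have P0 : P (x0, r) by rewrite /P /= far_X ?node_of_refl.
case: (arg_maxnP (fun t : V * V => #|reach G [set t.1; t.2]|) P0) => -[u w] /andP[/= Fu Nw] max_uw.
exists u, w; split=> //; have [u0 Nu far_u] := farP Fu; have w0 := N_neq0 Nw.
have uw : u != w by apply: contraNneq Nu => ->.
have wu : w != u by rewrite eq_sym.
have max_u z : z \in far -> ~~ (reach G [set u; w] \proper reach G [set z; w]).
  move=> Fz; apply/negP => /proper_card; rewrite ltnNge => /negP[].
  by apply: (max_uw (z, w)); rewrite /P /= Fz.
have max_w m : m \in N -> ~~ (reach G [set u; w] \proper reach G [set u; m]).
  move=> Nm; apply/negP => /proper_card; rewrite ltnNge => /negP[].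
  by apply: (max_uw (u, m)); rewrite /P /= Fu.
(* It suffices that w costs u no mass; a lost neighbour z of u is refuted below. *)
rewrite negb_and; apply/orP; left; apply/ltn_pmassP => // -[z [uz _ Rz]].
have z0 : z != ord0 by apply: contraNneq Rz => ->; apply: reach0.
have zu : z != u by rewrite eq_sym (adj_neq uz).
have zw : z != w.
  by apply: contraTneq uz => ->; rewrite adjC far_u ?node_of_refl.
have Nz : z \notin N by apply: contraTN uz => Nz; rewrite adjC far_u ?node_of_refl.
(* If z is far, trading u for z cuts off less. Otherwise z lies in a [Y]-node adjacent to [N]. *)
have [Fz|Fz] := boolP (z \in far).
  case/negP: (max_u z Fz); rewrite setUC [X in _ \proper reach G X]setUC.
  by rewrite setUC in Rz; case: (reach2_grow w0 u0 z0 wu zu (cross_reach w0 u0 wu) Rz).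
have [x [m [zx Nm mx]]] := not_farP z0 Nz Fz.
have nd_x : node_of x = node_of z := node_of_eq zx.
have Nx : x \notin N.
  by apply: contra Nz => /node_of_eq nd_xN; rewrite -nd_xN nd_x node_of_refl.
have x0' : x != ord0.
  by apply: contraNneq z0 => x0'; move: nd_x; rewrite x0' node_of0 => /setP/(_ z);
    rewrite node_of_refl in_set1.
have Yx : x \in Y := N_out Nm mx x0' Nx.
have sub_Y : node_of z \subset Y by rewrite -nd_x node_of_sub.
have Yz : z \in Y by apply: (subsetP sub_Y); apply: node_of_refl.
have zu_node : u \notin node_of z.
  by apply/negP => /node_of_eq nd_uz; have := far_u x m; rewrite nd_uz zx mx => /(_ isT Nm).
have zw_node : w \notin node_of z.
  by apply: contraL (NX Nw) => /(subsetP sub_Y); apply: contraTN; apply: X_notin_Y.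
have dis : [disjoint node_of z & [set u; w]].
  by rewrite disjoint_sym disjoints_subset subUset !sub1set !in_setC zu_node.
have cut y : y \in node_of z -> y \notin reach G [set u; w].
  move=> zy; apply: contra Rz => Ry; have nd_y := node_of_eq zy.
  apply: (nodeY_reach _ (subsetP sub_Y y zy) _ _ Ry); rewrite ?notin2 // nd_y //.
  exact: node_of_refl.
(* The whole node of z is cut off by {u, w}. An edge into it from another m' of [N] would put m'
   among the cut-off vertices, and trading w for m' would cut off less. *)
have only_w y m' : y \in node_of z -> m' \in N -> adj G m' y -> m' = w.
  move=> zy Nm' m'y; apply/eqP; apply: contraT => m'w.
  have Rm' : m' \notin reach G [set u; w].
    apply: contra (cut y zy) => Rm'; apply: (reach2_step u0 w0 Rm' m'y).
      by apply: contraNneq zu_node => <-.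
    by apply: contraNneq zw_node => <-.
  case/negP: (max_w m' Nm').
  by case: (reach2_grow u0 w0 (N_neq0 Nm') uw m'w (cross_reach u0 w0 uw) Rm').
(* In the graph without [N], the component of z is entered from [N] only through the node of z,
   since the component graph is a tree, and hence only from w. So w dominates z, against
   [cross_reach]. *)
pose C := [set y | connect (induced (adj G) (~: N)) z y].
have symN := induced_connect_sym (~: N) (@adjC _ G).
have C_notin y : y \in C -> y \notin N.
  rewrite in_set => conn; apply: (connect_stable (K := [pred v | v \notin N]) _ conn) => //.
  by move=> a b _; rewrite inducedE !in_setC => /and3P[_ ].
have CN : {subset reach G [set w] <= [pred y | y \notin C]}.
  apply: reach_ind => [|a b Ra Ca aw bw ab].
    rewrite !inE symN; apply/negP => conn; case/eqP: z0; symmetry; apply/eqP.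
    rewrite eq_sym; apply: (connect_stable (K := pred1 ord0) _ conn); rewrite ?inE //.
    move=> a b /eqP->; rewrite inducedE !in_setC => /and3P[_ Nb /root_node].
    by rewrite (negPf Nb).
  rewrite inE; apply: contra Ca => Cb; have Nb := C_notin b Cb.
  have [Na|Na] := boolP (a \in N); last first.
    move: Cb; rewrite !in_set => Cb; apply: connect_trans Cb (connect1 _).
    by rewrite inducedE !in_setC Na Nb adjC.
  suff zb : b \in node_of z by rewrite in_set1 (only_w b a zb Na ab) eqxx in aw.
  have conn_bx : connect (induced (adj G) (~: N)) b x.
    move: Cb; rewrite in_set symN => Cb; apply: connect_trans Cb _.
    apply: connect_sub (nodeY_connect Yz zx) => a' b'; rewrite inducedE => /and3P[za' zb' ab'].
    have notN v : v \in node_of z -> v \in ~: N.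
      by move/(subsetP sub_Y); rewrite in_setC; apply: contraL => /NX/X_notin_Y.
    by apply: connect1; rewrite inducedE !notN.
  by rewrite -nd_x -(node_of_unique tree Na Nm ab mx Nb Nx conn_bx) node_of_refl.
have := CN z (cross_reach w0 z0 _); rewrite eq_sym zw inE => /(_ isT)/negP[].
by rewrite in_set connect0.
Qed.

(** The far vertex of [far_pair] must lie in [X], since pairs across the sides are entangled;
    symmetry extends this one unentangled pair to all pairs in [X]. *)
Lemma X_unentangled : {in X &, forall x x', x != x' -> ~~ entangled G x x'}.
Proof.
have [u [w [Fu Nw ent]]] := far_pair; have [u0 Nu _] := farP Fu.
have Xu : u \in X.
  apply: contraR ent => Xu; rewrite entangledC cross ?(NX Nw) //.
  by rewrite XY.
have uw : u != w by apply: contraNneq Nu => ->.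
move=> x x' Xx Xx' xx'.
by case: (pair_perm X0 invX Xu (NX Nw) Xx Xx' uw xx') => <-.
Qed.

Lemma X_independent x x' : x \in X -> x' \in X -> adj G x x' = false.
Proof.
move=> Xx Xx'; apply/negP => xx'; have neq := adj_neq xx'.
have [x0 x'0] := (sideX_neq0 Xx, sideX_neq0 Xx').
have /negP[] := X_unentangled Xx Xx' neq.
by apply: adj_entangled; rewrite ?cross_reach // eq_sym.
Qed.

Lemma N_root w : w \in N -> adj G ord0 w.
Proof.
move=> Nw; have w0 := N_neq0 Nw; have := Nw; rewrite reach_Y => /andP[Xw Rw].
have [t Rt tw] := reach_entry Y0 Rw w0.
have wY0 : ord0 \notin w |: Y by rewrite in_setU1 negb_or eq_sym w0.
have := reach_notin wY0 Rt; rewrite in_setU1 negb_or => /andP[_ Yt].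
have [t0|t0] := eqVneq t ord0; first by rewrite -t0.
by rewrite X_independent // in tw; rewrite XY // negbK in Yt.
Qed.

Lemma outer_nbr x y : x \in X -> x \notin N -> adj G x y -> y \in Y.
Proof.
move=> Xx Nx xy; have y0 : y != ord0.
  by apply: contraNneq Nx => y0; apply: root_node; rewrite -y0 adjC.
by rewrite XY //; apply: contraTN xy => Xy; rewrite X_independent.
Qed.

Lemma outer_node x : x \in X -> x \notin N -> node_of x = [set x].
Proof.
move=> Xx Nx; apply/setP => y; rewrite in_set1; apply/idP/eqP => [|->]; last exact: node_of_refl.
rewrite (in_node_of _ _ sideX Xx) => /andP[_ conn]; apply/eqP.
apply: (connect_stable (K := pred1 x) _ conn); rewrite ?inE // => u v /eqP->.
rewrite inducedE => /and3P[_ Sv /(outer_nbr Xx Nx) Yv].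
case/setU1P: Sv => [v0|/X_notin_Y]; last by rewrite Yv.
by rewrite v0 (negPf Y0) in Yv.
Qed.

(** Here x is a node by itself, and its neighbours stay connected to the root without it, so two
    nodes around x would close a cycle. *)
Lemma outer_nbr_node x y1 y2 : x \in X -> x \notin N -> adj G x y1 -> adj G x y2 ->
  node_of y1 = node_of y2.
Proof.
move=> Xx Nx xy1 xy2; have x0 := sideX_neq0 Xx; have nd_x := outer_node Xx Nx.
have [y1x y2x] := (adj_neq xy1, adj_neq xy2).
apply: (node_of_unique tree (node_of_refl G x) (node_of_refl G x) xy1 xy2);
  rewrite nd_x ?in_set1 1?eq_sym //.
have symx := induced_connect_sym (~: [set x]) (@adjC _ G).
have R y : adj G x y -> connect (induced (adj G) (~: [set x])) ord0 y.
  move=> xy; rewrite -in_reach cross_reach ?(adj_neq xy) //.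
  by apply: sideY_neq0; apply: outer_nbr xy.
by apply: connect_trans (R y2 xy2); rewrite symx R.
Qed.

(* Every vertex of X outside N is then a node by itself, attached to a single Y-node, so there
   is only one Y-node, and it is adjacent to N. *)
Lemma one_Y_node : exists w y, [/\ w \in N, y \in Y, adj G w y & {subset Y <= node_of y}].
Proof.
have [x Xx Nx] := far_vertex; have x0 := sideX_neq0 Xx.
have [|y0 Ry0 y0x] := reach_entry _ (reach_set0 G x) x0; first by rewrite in_set0.
rewrite adjC in y0x; have Yy0 := outer_nbr Xx Nx y0x.
have nbr_x z : adj G x z -> z \in node_of y0.
  by move=> xz; rewrite (outer_nbr_node Xx Nx y0x xz) node_of_refl.
have [w [y [Nw yy0 wy]]] : exists w y, [/\ w \in N, y \in node_of y0 & adj G w y].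
  have [/exists_inP[w Nw /exists_inP[y yy0 wy]]|none] :=
    boolP [exists w in N, exists y in node_of y0, adj G w y]; first by exists w, y.
  have no_wy w y : w \in N -> y \in node_of y0 -> ~~ adj G w y.
    move=> Nw yy0; apply: contra none => wy.
    by apply/exists_inP; exists w => //; apply/exists_inP; exists y.
  (* If no edge joined [N] to the node of [y0], this node together with the vertices of [X] attached
     to it would be a union of components missing the root. *)
  pose D := [set z in X | (z \notin N) && [exists y in node_of y0, adj G z y]].
  have sub_Y := subsetP (node_of_sub G sideY Yy0).
  pose K := [pred z | (z \notin node_of y0) && (z \notin D)].
  suff /andP[] : y0 \in K by rewrite node_of_refl.
  apply: (reach_closedT (G := G)) => [|a b /andP[ya Da] ab].
    rewrite inE inE (negPf X0) andbT; apply: contraL (Y0) => /sub_Y.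
    by rewrite negbK.
  have yb : b \notin node_of y0.
    apply/negP => yb; case/negP: Da; rewrite inE.
    have a0 : a != ord0 by apply: contraTneq ab => ->; rewrite Y_not_root ?sub_Y.
    have Xa : a \in X.
      apply: contraR ya => Xa; rewrite -(node_of_eq yb).
      by apply: (adj_node_of sideY); rewrite ?(sub_Y b yb) 1?adjC // XY.
    rewrite Xa /=; apply/andP; split; first by apply: contraTN ab => Na; apply: no_wy.
    by apply/exists_inP; exists b.
  rewrite inE yb /=; apply: contra ya; rewrite inE => /and3P[Xb Nb /exists_inP[y yy0 byy]].
  have ba : adj G b a by rewrite adjC.
  by rewrite -(node_of_eq yy0) (outer_nbr_node Xb Nb byy ba) node_of_refl.
have Yy : y \in Y := subsetP (node_of_sub G sideY Yy0) y yy0.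
exists w, y; split=> // v Yv; apply: contraT => yv.
have v0 := sideY_neq0 Yv; have w0 := N_neq0 Nw.
(* A vertex v of [Y] in another node would cut some neighbour z of x off from the root; but z is in
   the node of y, which is reached through w. *)
have /andP[/(ltn_pmassP G x0 v0)[z [xz _ Rz]] _] := cross Xx Yv.
case/negP: Rz.
have S0 := notin2 x0 v0; have nd_y := node_of_eq yy0.
have dis : [disjoint node_of y & [set x; v]].
  rewrite disjoint_sym disjoints_subset subUset !sub1set !in_setC yv andbT.
  by apply: contraL (X_notin_Y Xx) => /(subsetP (node_of_sub G sideY Yy))->.
have yz : z \in node_of y by rewrite nd_y nbr_x.
apply: (nodeY_reach S0 Yy yz dis).
have notin u : u \in node_of y -> u \notin [set x; v] by move=> yu; rewrite (disjointFr dis yu).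
apply: (reach_step S0 _ wy) (notin y (node_of_refl G y)).
apply: (reach_step S0 (reach0 G _) (N_root Nw)); rewrite in_set2 negb_or.
apply/andP; split; first by apply: contraNneq Nx => <-.
by apply: contraTneq Yv => <-; apply: X_notin_Y; apply: NX.
Qed.

(** Since masses are constant on [X], a transposition inside [X] turns this function for one t in
    [X] into that for another. *)
Definition zero_at t v := if (v \in X) && (v != t) then (mass G v).-1 else 0.

Lemma zero_at_root_side w y : w \in N -> y \in Y -> adj G w y -> {subset Y <= node_of y} ->
  vparking G (zero_at w).
Proof.
move=> Nw Yy wy Y_nd U U0 /set0Pn[i0 Ui0]; have w0 := N_neq0 Nw.
pose S := X :\ w; have S0 : ord0 \notin S by rewrite in_setD1 (negPf X0) andbF.
have notS v : v \in Y -> v \notin S.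
  by move=> Yv; rewrite in_setD1; apply: contraL Yv => /andP[_ /X_notin_Y].
have Rw : w \in reach G S.
  by apply: reach_step S0 (reach0 G _) (N_root Nw) _; rewrite in_setD1 eqxx.
have RY v : v \in Y -> v \in reach G S.
  move=> Yv; apply: (nodeY_reach S0 Yy (Y_nd v Yv)).
    rewrite disjoint_sym disjoints_subset; apply/subsetP => x /setD1P[_ Xx].
    by rewrite in_setC; apply: contraL (X_notin_Y Xx) => /(subsetP (node_of_sub G sideY Yy))->.
  exact: reach_step S0 Rw wy (notS y Yy).
have [/existsP[i /andP[Ui Ri]]|/existsPn noR] := boolP [exists i, (i \in U) && (i \in reach G S)].
  have [i' [j [Ui' Ri' Rj Uj i'j]]] := reach_exit U0 Ui Ri.
  exists i' => //; rewrite /zero_at; have := reach_notin S0 Ri'.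
  rewrite in_setD1 andbC => /negPf->.
  by apply/wdeg_gt0; exists j; rewrite ?in_setC.
exists i0 => //; have i00 : i0 != ord0 by apply: contraNneq U0 => <-.
have Ri0 : i0 \notin reach G S by have := noR i0; rewrite Ui0.
have Xi0 : i0 \in X by apply: contraR Ri0 => Xi0; apply: RY; rewrite XY.
have i0w : i0 != w by apply: contraNneq Ri0 => ->.
(* Only unreached vertices of [X] are left in [U]. They are pairwise non-adjacent, so all neighbours
   of [i0] are outside [U] and its full mass is available. *)
rewrite /zero_at Xi0 i0w /= prednK ?mass_gt0 //; apply: leq_wdeg_adj => z _ i0z.
rewrite in_setC; have := noR z; apply: contra => Uz; rewrite Uz /=.
have z0 : z != ord0 by apply: contraNneq U0 => <-.
by apply: RY; rewrite XY //; apply: contraTN i0z => Xz; rewrite X_independent.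
Qed.

(** The first vertex to burn would be a root neighbour in [N], with value one less than its mass.
    But entanglement with [Y] shows that part of that mass comes from an edge not going to the
    root. *)
Lemma zero_at_far_side x : x \in X -> x \notin N -> ~ vparking G (zero_at x).
Proof.
move=> Xx Nx park; have [||i] := park (~: [set ord0]).
- by rewrite in_setC in_set1 eqxx.
- by apply/set0Pn; exists x; rewrite in_setC in_set1 sideX_neq0.
rewrite setCK /wdeg big_set1 => _ lt_i.
have i0 : adj G i ord0 by apply: leq_ltn_trans lt_i.
have Ni : i \in N by apply: root_node; rewrite adjC.
have Xi := NX Ni; have i_neq0 := N_neq0 Ni.
have ix : i != x by apply: contraNneq Nx => <-.
have /set0Pn[y Yy] := Y_neq0.
have /andP[/(ltn_pmassP G i_neq0 (sideY_neq0 Yy))[z [iz Rz Rz']] _] := cross Xi Yy.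
have z0 : z != ord0 by apply: contraNneq Rz' => ->; apply: reach0.
move: lt_i; rewrite /zero_at Xi ix /= prednK ?mass_gt0 //.
rewrite /mass /wdeg (bigD1 ord0) ?reach0 //= (bigD1 z) /=; last by rewrite Rz.
by rewrite addnA -[X in _ <= X]addn0 -addnA leq_add2l leqn0 addn_eq0 (gtn_eqF iz).
Qed.

Lemma cross_contradiction : False.
Proof.
have [w [y [Nw Yy wy Y_nd]]] := one_Y_node; have [x Xx Nx] := far_vertex.
apply: (zero_at_far_side Xx Nx).
apply: vparking_ext (invX (NX Nw) Xx (zero_at_root_side Nw Yy wy Y_nd)) => v /=.
rewrite /zero_at; have Xw := NX Nw; case: tpermP => [->|->|/eqP vw /eqP vx].
- have wx : w != x by apply: contraNneq Nx => <-.
  by rewrite Xx Xw wx eq_sym wx (mass_const X0 invX Xx Xw).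
- by rewrite !eqxx !andbF.
by rewrite vw vx.
Qed.

End CrossEntangled.

(** * The three shapes *)

Section Shapes.
Variables (p q : nat) (G : rooted_graph (p + q)).
Local Notation V := 'I_(p + q).+1.
Local Notation node_of := (node_of G).
Implicit Types (S X Y : {set V}) (u v w x y z : V).

(** The given walk to i is shorter than every walk to j, so it cannot pass through j. *)
Lemma farther_reach i j : farther G i j -> j != ord0 /\ i \in reach G [set j].
Proof.
case=> s [path_s last_s far_j].
have j0 : j != ord0.
  by apply/eqP => j0; have := far_j [::] isT (esym j0).
have js : j \notin s.
  apply/negP => js; case/splitPr: js path_s far_j {last_s} => s1 s2.
  rewrite cat_path /= => /and3P[path_s1 last_s1 _] /(_ (rcons s1 j)).
  rewrite rcons_path path_s1 last_s1 last_rcons size_rcons size_cat /= addnS ltnS.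
  by move=> /(_ isT erefl); rewrite ltnNge leq_addr.
split=> //; rewrite -last_s; have := reach0 G [set j].
elim: s ord0 path_s js {last_s far_j} => //= y s IHs x /andP[xy path_s].
rewrite inE negb_or => /andP[jy js] Rx; apply: IHs path_s js _.
by apply: (reach1_step j0 Rx xy); rewrite eq_sym.
Qed.

Lemma unentangled_weighted_tree S a : S != set0 -> connected_on (adj G) S ->
  (forall x z, x \in S -> x != ord0 -> z != ord0 -> z != x -> ~~ entangled G z x) ->
  (forall x, x \in S -> x != ord0 -> mass G x = a) -> weighted_tree G a S.
Proof.
move=> S0 connS nent massS; split.
  split=> //; apply: acyclic_unentangled => x y Sx Sy x0 y0.
  have [->|xy] := eqVneq x y; last exact: nent.
  by apply/negP => /(entangled_neq y0 y0); rewrite eqxx.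
have wt_a x y : x \in S -> y \in S -> y != ord0 -> adj G x y ->
    x \in reach G [set y] -> wt G x y = a.
  by move=> Sx Sy y0 xy Rx; rewrite wt_parent ?massS // => z z0 zy; apply: nent.
move=> x y Sx Sy xy; have [x0|x0] := eqVneq x ord0.
  have y0 : y != ord0 by rewrite -x0 eq_sym (adj_neq xy).
  by apply: wt_a => //; rewrite x0 reach0.
have [y0|y0] := eqVneq y ord0.
  by rewrite wt_sym; apply: wt_a => //; rewrite ?y0 ?reach0 // adjC -y0.
have := dominates_asym G x0 y0 (adj_neq xy); case/orP=> R.
  by rewrite wt_sym; apply: wt_a; rewrite // adjC.
exact: wt_a.
Qed.

Lemma unentangled_ab_tree a b :
  (forall x y, x != ord0 -> y != ord0 -> x != y -> ~~ entangled G x y) ->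
  (forall x, x \in Aset p q -> mass G x = a) -> (forall x, x \in Bset p q -> mass G x = b) ->
  ab_tree G a b.
Proof.
move=> nent massA massB; split.
  split; first by apply/set0Pn; exists ord0; rewrite inE.
    exact: (wt_connected G).
  apply: acyclic_unentangled => x y _ _ x0 y0; have [->|xy] := eqVneq x y; last exact: nent.
  by apply/negP => /(entangled_neq y0 y0); rewrite eqxx.
move=> i j ij /farther_reach[j0 Ri].
have wt_ij : wt G i j = mass G j by apply: wt_parent => // z z0 zj; apply: nent.
by split=> [/massA|/massB] <-.
Qed.

(** A path inside [ord0 |: S] joining two vertices of the node may use the root; its neighbours on
    that path then lie in the node, so [node_component] contains the root. *)
Lemma node_componentP S x : is_side S -> x \in S ->
  connected_on (adj G) (node_component G (node_of x)).
Proof.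
move=> sideS Sx; set C := node_component _ _.
have symC := induced_connect_sym C (@adjC _ G).
have S0 := side0 sideS; have sub_S := subsetP (node_of_sub G sideS Sx).
have memC u : u \in C -> u \in node_of x \/ u = ord0 /\ exists2 m, m \in node_of x & adj G ord0 m.
  rewrite /C /node_component; case: ifP => [/exists_inP ex|_]; last by left.
  by case/setU1P=> [->|]; [right | left].
have node_C u : u \in node_of x -> u \in C.
  by rewrite /C /node_component; case: ifP => // _ xu; rewrite setU1r.
have root_C m : m \in node_of x -> adj G ord0 m -> ord0 \in C.
  move=> xm m0; rewrite /C /node_component ifT ?setU11 //.
  by apply/exists_inP; exists m.
suff conn u : u \in C -> connect (induced (adj G) C) x u.
  by move=> u v Cu Cv; apply: connect_trans (conn v Cv); rewrite symC conn.
have conn_node v : v \in node_of x -> connect (induced (adj G) C) x v.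
  rewrite (in_node_of _ _ sideS Sx) => /andP[_ conn].
  pose K := [pred v | (v \in C) && connect (induced (adj G) C) x v].
  suff /andP[] : v \in K by [].
  apply: (connect_stable (K := K) _ conn); last by rewrite inE connect0 node_C ?node_of_refl.
  move=> y z /andP[Cy conn_y]; rewrite inducedE => /and3P[_ Sz yz].
  suff Cz : z \in C.
    by rewrite inE Cz; apply: connect_trans conn_y (connect1 _); rewrite inducedE Cy Cz.
  case/setU1P: Sz => [z0|Sz]; case: (memC y Cy) => [xy|[y0 [m xm m0]]].
  - by rewrite z0; apply: root_C xy _; rewrite adjC -z0.
  - by rewrite z0 -y0.
  - by apply: node_C; rewrite -(node_of_eq xy) (adj_node_of sideS (sub_S y xy) Sz yz).
  apply: node_C; rewrite -(node_of_eq xm) (in_node_of _ _ sideS (sub_S m xm)) Sz.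
  apply: (@connect_trans _ _ ord0); apply: connect1;
    rewrite inducedE setU11 setU1r ?(sub_S m xm) //=.
    by rewrite adjC.
  by rewrite -y0.
move=> Cu; case: (memC u Cu) => [|[u0 [m xm m0]]]; first exact: conn_node.
apply: connect_trans (conn_node m xm) (connect1 _).
by rewrite inducedE node_C // Cu u0 adjC.
Qed.

Section OneBigNode.
Variables X Y : {set V}.
Hypotheses (sideX : is_side X) (sideY : is_side Y).
Hypothesis XY : forall v, v != ord0 -> (v \in Y) = (v \notin X).
Hypothesis no_cross : forall x y, x \in X -> y \in Y -> ~~ entangled G x y.
Hypotheses (invX : swap_invariant G X) (invY : swap_invariant G Y).

Lemma outside_unentangled x y : x != ord0 -> x \notin Y -> y \in Y -> ~~ entangled G x y.
Proof. by move=> x0 Yx Yy; rewrite no_cross // -[x \in X]negbK -XY. Qed.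

Variables y1 y2 : V.
Hypotheses (Yy1 : y1 \in Y) (Yy2 : y2 \in Y) (y12 : y1 != y2) (ent12 : entangled G y1 y2).
Hypothesis disconnectedY : ~ connected_on (adj G) (ord0 |: Y).

Let Y0 := side0 sideY.

Let card_Y : 1 < #|Y|.
Proof. by rewrite (cardsD1 y1) Yy1 (cardsD1 y2) !inE eq_sym y12 Yy2. Qed.

Let inner : {in Y &, forall x y, x != y -> entangled G x y}.
Proof.
by move=> x y Yx Yy xy; case: (pair_perm Y0 invY Yx Yy Yy1 Yy2 xy y12) => ->.
Qed.

Let massY : {in Y &, forall x y, mass G x = mass G y}.
Proof. by move=> x y; apply: mass_const. Qed.

(** This natural-number subtraction is not truncated, because the pair is entangled. *)
Let eps := mass G y1 - pmass G y1 y2.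

Let mass_inner : {in Y &, forall x y, x != y -> mass G x = pmass G x y + eps}.
Proof.
move=> x y Yx Yy xy; have [_ -> //] := pair_perm Y0 invY Yx Yy Yy1 Yy2 xy y12; last exact: inner.
by rewrite subnKC ?(massY Yx Yy1) // ltnW //; case/andP: ent12.
Qed.

(** [Y] is connected by its own edges, so a gate at the root would make [ord0 |: Y] connected. *)
Lemma dominating_gate : exists i w, [/\ i \in reach G Y, w \in Y, adj G i w, i != ord0
  & forall y, y \in Y -> y \notin reach G [set i]].
Proof.
have [i [w [Ri Yw iw]]] := gate_exists G Y0 card_Y; exists i, w.
have i0 : i != ord0.
  apply: contra_notN disconnectedY => /eqP i0; rewrite i0 in iw.
  have symY := induced_connect_sym (ord0 |: Y) (@adjC _ G).
  have subY : subrel (connect (induced (adj G) Y)) (connect (induced (adj G) (ord0 |: Y))).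
    apply: connect_sub => x y; rewrite inducedE => /and3P[Yx Yy xy]; apply: connect1.
    by rewrite inducedE !setU1r.
  have conn y : y \in ord0 |: Y -> connect (induced (adj G) (ord0 |: Y)) ord0 y.
    case/setU1P=> [->|Yy]; first exact: connect0.
    apply: connect_trans (connect1 _) (subY w y _).
      by rewrite inducedE setU11 setU1r.
    exact: (inner_connected Y0 outside_unentangled inner).
  by move=> x y Sx Sy; apply: connect_trans (conn y Sy); rewrite symY conn.
split=> //; apply: (outer_dominates Y0 outside_unentangled inner i0 _ Yw iw).
  exact: reach_notin Ri.
by apply: (subsetP (reach_inner G Y0 _)) Ri; rewrite sub1set.
Qed.

Hypothesis no_inner : {in X &, forall x x', x != x' -> ~~ entangled G x x'}.

Lemma big_node a : {in X, forall x, mass G x = a} ->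
  exists b c, [/\ 0 < b, 0 < c & one_big_node G X Y a b c].
Proof.
move=> massX; have [i [w [Ri Yw iw i0 _]]] := dominating_gate.
have [b [c [b0 c0 shape]]] :=
  inner_shape Y0 card_Y outside_unentangled inner mass_inner massY Ri Yw iw.
exists b, c; split=> //.
have nodeY y : y \in Y -> node_of y = Y.
  move=> Yy; apply/eqP; rewrite eqEsubset node_of_sub //=; apply/subsetP => z Yz.
  rewrite (in_node_of _ _ sideY Yy) Yz /=.
  apply: connect_sub (inner_connected Y0 outside_unentangled inner Yy Yz) => u v.
  by rewrite inducedE => /and3P[Yu Yv uv]; apply: connect1; rewrite inducedE !setU1r.
have nodes_Y : nodes_in G Y = [set Y].
  apply/setP => N; rewrite inE in_set1; apply/andP/eqP => [[/nodesP[x Nx ->]]|->].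
    by move=> /subsetP/(_ x (node_of_refl _ _)); apply: nodeY.
  by rewrite -(nodeY w Yw) node_of_nodes (nodeY w Yw).
split; first by rewrite nodes_Y cards1.
  by exists i => //; rewrite -[i \in X]negbK -XY //; apply: reach_notin Ri.
move=> N /nodesP[x _ ->]; rewrite nodes_Y in_set1 => not_Y.
have Xx : x != ord0 -> x \in X.
  by move=> x0; rewrite -[x \in X]negbK -XY //; apply: contra not_Y => /nodeY->.
have comp_sub y : y \in node_component G (node_of x) -> y != ord0 -> y \in X.
  move=> Cy y0; suff xy : y \in node_of x.
    have [x0|x0] := eqVneq x ord0; last exact: (subsetP (node_of_sub G sideX (Xx x0))).
    by rewrite x0 node_of0 in_set1 (negPf y0) in xy.
  by move: Cy; rewrite /node_component; case: ifP => // _ /setU1P[/eqP|]; rewrite ?(negPf y0).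
apply: unentangled_weighted_tree.
- apply/set0Pn; exists x; rewrite /node_component.
  by case: ifP => _; rewrite ?in_setU1 node_of_refl ?orbT.
- have [->|x0] := eqVneq x ord0; last exact: (node_componentP sideX (Xx x0)).
  have C0 : node_component G (node_of ord0) = [set ord0].
    rewrite /node_component node_of0 ifF //; apply/negbTE/exists_inPn => v /set1P->.
    by rewrite adjxx.
  by rewrite C0 => u v /set1P-> /set1P->.
- move=> y z Cy y0 z0 zy; have Xy := comp_sub y Cy y0.
  have [Xz|Xz] := boolP (z \in X); first exact: no_inner.
  by rewrite entangledC no_cross ?XY.
by move=> y Cy y0; apply/massX/comp_sub.
Qed.

End OneBigNode.
End Shapes.

(** * The case distinction on entangled pairs *)

Theorem theorem6p20 (p q : nat) (p_gt0 : 0 < p) (q_gt0 : 0 < q)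
    (G : rooted_graph (p + q)) :
  type_II G ->
  component_graph_is_tree G ->
  exists a b c : nat,
    [/\ 0 < a, 0 < b & 0 < c] /\
    [\/ ab_tree G a b,
        one_big_node G (Aset p q) (Bset p q) a b c
      | one_big_node G (Bset p q) (Aset p q) a b c].
Proof.
case=> discA discB inv tree.
have invA := swap_invariantA inv; have invB := swap_invariantB inv.
have sideA : is_side (Aset p q) by left.
have sideB : is_side (Bset p q) by right.
have [A0 B0] := (Aset0 p q, Bset0 p q).
have AB v : v != ord0 -> (v \in Bset p q) = (v \notin Aset p q) by apply: in_AB.
have BA v : v != ord0 -> (v \in Aset p q) = (v \notin Bset p q).
  by move=> v0; rewrite AB // negbK.
have [a0 Aa0] : exists x, x \in Aset p q.
  by exists (lift ord0 (lshift q (Ordinal p_gt0))); apply/AsetP; exists (Ordinal p_gt0).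
have [b0 Bb0] : exists x, x \in Bset p q.
  by exists (lift ord0 (rshift p (Ordinal q_gt0))); apply/BsetP; exists (Ordinal q_gt0).
have [a00 b00] : a0 != ord0 /\ b0 != ord0.
  by split; [apply: contraTneq Aa0 | apply: contraTneq Bb0] => ->.
have notA y : y \in Bset p q -> y \notin Aset p q.
  by move=> By; rewrite -AB //; apply: contraTneq By => ->.
have notB x : x \in Aset p q -> x \notin Bset p q.
  by move=> Ax; rewrite -BA //; apply: contraTneq Ax => ->.
have cross_const x y : x \in Aset p q -> y \in Bset p q -> entangled G x y = entangled G a0 b0.
  move=> Ax By; have y0 : y != ord0 by apply: contraTneq By => ->.
  rewrite (entangled_constl A0 invA Ax Aa0 (notA y By) y0) entangledC.
  by rewrite (entangled_constl B0 invB By Bb0 (notB a0 Aa0) a00) entangledC.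
have massA : {in Aset p q, forall x, mass G x = mass G a0}.
  by move=> x Ax; apply: mass_const A0 invA _ _ _ _.
have massB : {in Bset p q, forall x, mass G x = mass G b0}.
  by move=> x Bx; apply: mass_const B0 invB _ _ _ _.
have [a_gt0 b_gt0] := (mass_gt0 G a00, mass_gt0 G b00).
have [ent|nent] := boolP (entangled G a0 b0).
  have crossAB x y : x \in Aset p q -> y \in Bset p q -> entangled G x y.
    by move=> Ax By; rewrite cross_const.
  have crossBA y x : y \in Bset p q -> x \in Aset p q -> entangled G y x.
    by move=> By Ax; rewrite entangledC crossAB.
  have [An0 Bn0] : Aset p q != set0 /\ Bset p q != set0.
    by split; apply/set0Pn; [exists a0 | exists b0].
  have [r root_r] : exists r, adj G ord0 r.
    have [/existsP//|/existsPn none] := boolP [exists r, adj G ord0 r].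
    suff : a0 \in pred1 ord0 by rewrite inE (negPf a00).
    move: (a0); apply: (reach_closedT (G := G)) => [|x y /eqP->]; rewrite ?inE //.
    by rewrite (negPf (none y)).
  have r0 : r != ord0 by rewrite eq_sym (adj_neq root_r).
  (* The side containing a neighbour of the root plays the part of [X]. *)
  have [Ar|Br] := boolP (r \in Aset p q).
    by case: (cross_contradiction sideA sideB AB An0 Bn0 crossAB tree invA discA Ar root_r).
  rewrite -AB // in Br.
  by case: (cross_contradiction sideB sideA BA Bn0 An0 crossBA tree invB discB Br root_r).
have ncrossAB x y : x \in Aset p q -> y \in Bset p q -> ~~ entangled G x y.
  by move=> Ax By; rewrite cross_const.
have ncrossBA y x : y \in Bset p q -> x \in Aset p q -> ~~ entangled G y x.
  by move=> By Ax; rewrite entangledC ncrossAB.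
have innerP (S : {set 'I_(p + q).+1}) :
    (exists x y, [/\ x \in S, y \in S, x != y & entangled G x y]) \/
    {in S &, forall x y, x != y -> ~~ entangled G x y}.
  have [/existsP[x /existsP[y /and4P[Sx Sy xy ent]]]|/existsPn none] :=
    boolP [exists x, exists y, [&& x \in S, y \in S, x != y & entangled G x y]].
    by left; exists x, y.
  right=> x y Sx Sy xy; apply/negP => ent.
  by have /existsPn/(_ y) := none x; rewrite Sx Sy xy ent.
case: (innerP (Aset p q)) => [[x1 [x2 [Ax1 Ax2 x12 entA]]]|nentA];
  case: (innerP (Bset p q)) => [[y1 [y2 [By1 By2 y12 entB]]]|nentB].
(* With entangled pairs on both sides, the gate of B lies in A and that of A in B, so each would
   dominate the other. *)
- have [i [_ [Ri _ _ i0 domB]]] :=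
    dominating_gate sideB AB ncrossAB invB By1 By2 y12 entB discB.
  have [j [_ [Rj _ _ j0 domA]]] :=
    dominating_gate sideA BA ncrossBA invA Ax1 Ax2 x12 entA discA.
  have Ai : i \in Aset p q by rewrite BA //; apply: reach_notin Ri.
  have Bj : j \in Bset p q by rewrite AB //; apply: reach_notin Rj.
  have ij : i != j by apply: contraTneq Ai => ->; apply: notA.
  by have := dominates_asym G i0 j0 ij; rewrite (negPf (domA i Ai)) (negPf (domB j Bj)).
- have [b [c [b_pos c_pos big]]] :=
    big_node sideB sideA BA ncrossBA invA Ax1 Ax2 x12 entA discA nentB massB.
  by exists (mass G b0), b, c; split=> //; constructor 3.
- have [b [c [b_pos c_pos big]]] :=
    big_node sideA sideB AB ncrossAB invB By1 By2 y12 entB discB nentA massA.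
  by exists (mass G a0), b, c; split=> //; constructor 2.
(* With no entangled pair, every edge weighs as much as the mass of its farther end, which is
   constant on each side. *)
exists (mass G a0), (mass G b0), 1; split=> //; constructor 1.
apply: unentangled_ab_tree => // x y x0 y0 xy.
have [Ax|Bx] := boolP (x \in Aset p q); have [Ay|By] := boolP (y \in Aset p q).
- exact: nentA.
- by rewrite ncrossAB // AB.
- by rewrite ncrossBA // AB.
by apply: nentB; rewrite // AB.
Qed.
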